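(* Consider Problem ESQ: $\max_{X_T\in\mathcal X}\mathbb E[U((X_T-D_T)^+)]$ subject to $\mathbb E[\xi(L-X_T)^+]\le\epsilon_{\mathbb Q}$ and $\mathbb E[\xi X_T]\le x_0$. Its optimal terminal wealth is as follows. (i) If $L\le D_T$: $$X_T^{ESQ}=\left((U')^{-1}(\lambda_1\xi)+D_T\right)\mathbf 1_{\xi<\xi_2}\quad\text{if }\xi_2\le\xi_1,$$ $$X_T^{ESQ}=\left((U')^{-1}(\lambda_1\xi)+D_T\right)\mathbf 1_{\xi<\xi_1}+L\,\mathbf 1_{\xi_1\le\xi<\xi_2}\quad\text{if }\xi_1<\xi_2,$$ where $\xi_1=U'(\widetilde L-(D_T-L))/\lambda_1$, $\widetilde L$ is the tangent point of $U((X_T-D_T+L)^+)$, $\xi_2$ is defined through $\mathbb E[\xi L\mathbf 1_{\xi\ge\xi_2}]=\epsilon_{\mathbb Q}$, and $\lambda_1$ is obtained by solving $\mathbb E[\xi X_T^{ESQ}]=x_0$. (ii) If $D_T<L\le\widehat D_T$: $$X_T^{ESQ}=\left((U')^{-1}(\lambda_1\xi)+D_T\right)\mathbf 1_{\xi<\xi_2}\quad\text{if }\xi_2<\xi_1,$$ $$X_T^{ESQ}=\left((U')^{-1}(\lambda_1\xi)+D_T\right)\mathbf 1_{\xi<\xi_1}+L\,\mathbf 1_{\xi_1\le\xi<\xi_2}\quad\text{if }\xi_1\le\xi_2,$$ where $\xi_1=U'(L-D_T)/\lambda_1$, $\xi_2$ is defined through $\mathbb E[\xi L\mathbf 1_{\xi\ge\xi_2}]=\epsilon_{\mathbb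 Q}$, and $\lambda_1$ is obtained by solving $\mathbb E[\xi X_T^{ESQ}]=x_0$. (iii) If $L>\widehat D_T$: $$X_T^{ESQ}=\left((U')^{-1}(\lambda_1\xi)+D_T\right)\mathbf 1_{\xi<\xi_1}+L\,\mathbf 1_{\xi_1\le\xi<\xi_2}+\left((U')^{-1}(\xi(\lambda_1-\lambda_2))+D_T\right)\mathbf 1_{\xi_2\le\xi<\xi_3},$$ where $\xi_1=\frac{U'(L-D_T)}{\lambda_1}$, $\xi_2=\frac{U'(L-D_T)}{\lambda_1-\lambda_2}$, $\xi_3=\frac{U'(\widehat D_T-D_T)}{\lambda_1-\lambda_2}$, and $\lambda_1,\lambda_2$ are obtained by solving $\mathbb E[\xi X_T^{ESQ}]=x_0$ and $\mathbb E[\xi(L-X_T^{ESQ})^+]=\epsilon_{\mathbb Q}$.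
   Context: Market. Fix $T<\infty$ and a complete, frictionless continuous-time financial market with one risk-free asset $S_0$ and $m$ risky assets on a filtered probability space with physical measure $\mathbb P$ and unique local martingale measure $\mathbb Q$. $\mathbb E$ denotes expectation under $\mathbb P$. The state price density at time $T$ is $\xi=\frac{S_0(0)}{S_0(T)}\frac{d\mathbb Q}{d\mathbb P}$, assumed to be atomless. The initial capital is $x_0>0$, and $\mathcal X$ is the set of all $\mathcal F_T$-measurable, replicable, non-negative terminal wealths $X_T$ with $\mathbb E[\xi X_T]=x_0$. Utility and debt. $D_T>0$ is a constant (terminal debt level); $L>0$ and $\epsilon_{\mathbb Q}>0$ are given constants. $U:[0,\infty)\to\mathbb R$ is strictly increasing, strictly concave, continuously differentiable on $(0,\infty)$, bounded from below with $U(0)=0$, and satisfies $\lim_{x\to0}U'(x)=\infty$, $\lim_{x\to\infty}U'(x)=0$, $\limsup_{x\to\infty}xU'(x)/U(x)<1$. $(U')^{-1}$ is the inverse function of $U'$. For $d>0$ the tangent point of $U((x-d)^+)$ is the unique $\hat d>d$ with $U(\hat d-d)/\hat d=U'(\hat d-d)$; $\widehat D_T$ is the tangent point for $d=D_T$, and for $L<D_T$, $\widetilde L$ is the tangent point for $d=D_T-L$. For $L=D_T$ one reads $\xi_1=+\infty$. Standing assumptions: an optimal solution of the problem exists, and the risk constraint is non-redundant, i.e. the optimal solution $X_T^B=[(U')^{-1}(\lambda_B\xi)+D_T]\mathbf 1_{\xi<\xi_B}$ of the problem without risk constraint (with $\xi_B=U'(\widehat D_T-D_T)/\lambda_B$ and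 $\lambda_B$ solving $\mathbb E[\xi X_T^B]=x_0$) violates the risk constraint. $\lambda_1,\lambda_2$ are the Lagrangian multipliers of the budget and the risk constraint.
   Formalization: Existence of λ1 (and λ2) solving the stated equations is claimed only if some terminal wealth meets the risk constraint strictly; in the boundary case x0 = E[ξL] − ε finite solutions may fail to exist. Optimality holds for every solution. *)

(* Defs.v *)
From HB Require Import structures.
From mathcomp Require Import all_boot all_order all_algebra.
From mathcomp Require Import all_classical all_reals all_analysis.

Set Implicit Arguments.
Unset Strict Implicit.
Unset Printing Implicit Defensive.

Import Order.TTheory GRing.Theory Num.Theory.
Import numFieldNormedType.Exports.

Local Open Scope classical_set_scope.
Local Open Scope ring_scope.

(* Measurability of a real random variable with respect to a
   sub-sigma-algebra G, given as a family of events. *)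
Definition measurable_wrt (R : realType) (Omega : Type) (G : set (set Omega))
    (X : Omega -> R) : Prop :=
  forall B : set R, measurable B -> G (X @^-1` B).

(* Processes are indexed by R; only times in [0, T] matter. *)
Definition adapted (R : realType) (Omega : Type) (T : R)
    (F : R -> set (set Omega)) (M : R -> Omega -> R) : Prop :=
  forall t, 0 <= t <= T -> measurable_wrt (F t) (M t).

Definition cadlag_on (R : realType) (T : R) (f : R -> R) : Prop :=
  (forall t, 0 <= t < T -> f s @[s --> t^'+] --> f t) /\
  (forall t, 0 < t <= T -> cvg (f s @[s --> t^'-])).

(* E[M_t | F_s] = M_s is expressed by equality of the integrals over all
   events of F_s. *)
Definition martingale (R : realType) (d : measure_display)
    (Omega : measurableType d) (Q : probability Omega R) (T : R)
    (F : R -> set (set Omega)) (M : R -> Omega -> R) : Prop :=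
  [/\ adapted T F M,
      (forall t, 0 <= t <= T -> Q.-integrable setT (fun w => (M t w)%:E)) &
      (forall s t (A : set Omega), 0 <= s -> s <= t -> t <= T -> F s A ->
         (\int[Q]_(w in A) (M t w)%:E = \int[Q]_(w in A) (M s w)%:E)%E)].

Definition stopping_time (R : realType) (Omega : Type) (T : R)
    (F : R -> set (set Omega)) (tau : Omega -> R) : Prop :=
  (forall w, 0 <= tau w <= T) /\
  (forall t, 0 <= t <= T -> F t [set w | tau w <= t]).

Definition local_martingale (R : realType) (d : measure_display)
    (Omega : measurableType d) (Q : probability Omega R) (T : R)
    (F : R -> set (set Omega)) (M : R -> Omega -> R) : Prop :=
  [/\ adapted T F M,
      {ae Q, forall w, cadlag_on T (M ^~ w)} &
      exists tau : nat -> Omega -> R,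
        [/\ (forall n, stopping_time T F (tau n)),
            (forall n w, tau n w <= tau n.+1 w),
            {ae Q, forall w, exists n, tau n w = T} &
            (forall n, martingale Q T F
               (fun t w => M (Num.min t (tau n w)) w))]].

Definition equivalent_on (R : realType) (d : measure_display)
    (Omega : measurableType d) (G : set (set Omega))
    (P Q : probability Omega R) : Prop :=
  forall A, G A -> (Q A = 0%E <-> P A = 0%E).

Definition is_LMM (R : realType) (d : measure_display)
    (Omega : measurableType d) (P : probability Omega R) (T : R)
    (F : R -> set (set Omega)) (m : nat)
    (S0 : R -> Omega -> R) (S : 'I_m -> R -> Omega -> R)
    (Q : probability Omega R) : Prop :=
  equivalent_on (F T) P Q /\
  forall i, local_martingale Q T F (fun t w => S i t w / S0 t w).

(* Stochastic integration is not available, so the set of value processes of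
   admissible (nonnegative) self-financing strategies is a component of the
   market; it contains the nonnegative buy-and-hold positions, is stable under
   nonnegative combinations, and discounted value processes are local
   martingales under Q.  Completeness is the field [complete]. *)
Record market (R : realType) (d : measure_display) (Omega : measurableType d)
    (P : probability Omega R) (T : R) (m : nat) := Market {
  horizon_gt0 : 0 < T;
  filt : R -> set (set Omega);
  filt_sigma_algebra :
    forall t, 0 <= t <= T -> sigma_algebra setT (filt t);
  filt_measurable : forall t, 0 <= t <= T -> filt t `<=` measurable;
  filt_mono : forall s t, 0 <= s -> s <= t -> t <= T -> filt s `<=` filt t;
  filt0_trivial : forall A, filt 0 A -> P A = 0%E \/ P A = 1%E;
  bond : R -> Omega -> R;
  bond_gt0 : forall t w, 0 <= t <= T -> 0 < bond t w;
  bond_adapted : adapted T filt bond;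
  stock : 'I_m -> R -> Omega -> R;
  stock_adapted : forall i, adapted T filt (stock i);
  lmm : probability Omega R;
  lmm_is_LMM : is_LMM P T filt bond stock lmm;
  lmm_unique : forall Q', is_LMM P T filt bond stock Q' ->
    forall A, filt T A -> Q' A = lmm A;
  (* the density dQ/dP on the sigma-algebra filt T *)
  dQdP : Omega -> R;
  dQdP_ge0 : forall w, 0 <= dQdP w;
  dQdP_measurable : measurable_wrt (filt T) dQdP;
  dQdP_density : forall A, filt T A ->
    lmm A = (\int[P]_(w in A) (dQdP w)%:E)%E;
  wealth : set (R -> Omega -> R);
  wealth_adapted : forall V, wealth V -> adapted T filt V;
  wealth_ge0 : forall V, wealth V -> forall t w, 0 <= t <= T -> 0 <= V t w;
  wealth_buy_hold : forall (a : R) (b : 'I_m -> R),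
    let V := fun t w => a * bond t w + \sum_i b i * stock i t w in
    (forall t w, 0 <= t <= T -> 0 <= V t w) -> wealth V;
  wealth_cone : forall V W (a b : R), wealth V -> wealth W ->
    0 <= a -> 0 <= b -> wealth (fun t w => a * V t w + b * W t w);
  wealth_local_martingale : forall V, wealth V ->
    local_martingale lmm T filt (fun t w => V t w / bond t w);
  complete : forall X : Omega -> R,
    measurable_wrt (filt T) X -> (forall w, 0 <= X w) ->
    ('E_P[(fun w => bond 0 w / bond T w * dQdP w * X w)%R] < +oo)%E ->
    exists V, [/\ wealth V, {ae P, forall w, V T w = X w} &
      {ae P, forall w,
        (V 0 w)%:E = 'E_P[(fun w => bond 0 w / bond T w * dQdP w * X w)%R]%E}]
}.

Definition state_price (R : realType) (d : measure_display)
    (Omega : measurableType d) (P : probability Omega R) (T : R) (m : nat)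
    (M : market P T m) : Omega -> R :=
  fun w => bond M 0 w / bond M T w * dQdP M w.

Definition atomless_rv (R : realType) (d : measure_display)
    (Omega : measurableType d) (P : probability Omega R) (X : Omega -> R) :
    Prop :=
  forall c : R, P (X @^-1` [set c]) = 0%E.

Definition replicable (R : realType) (d : measure_display)
    (Omega : measurableType d) (P : probability Omega R) (T : R) (m : nat)
    (M : market P T m) (X : Omega -> R) : Prop :=
  exists2 V, wealth M V & {ae P, forall w, V T w = X w}.

Definition claim (R : realType) (d : measure_display)
    (Omega : measurableType d) (P : probability Omega R) (T : R) (m : nat)
    (M : market P T m) (X : Omega -> R) : Prop :=
  [/\ measurable_wrt (filt M T) X, replicable M X & forall w, 0 <= X w].

(* E[xi X], the price of the terminal payoff X. *)
Definition price (R : realType) (d : measure_display)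
    (Omega : measurableType d) (P : probability Omega R) (T : R) (m : nat)
    (M : market P T m) (X : Omega -> R) : \bar R :=
  'E_P[(fun w => state_price M w * X w)%R]%E.

Definition terminal_wealths (R : realType) (d : measure_display)
    (Omega : measurableType d) (P : probability Omega R) (T : R) (m : nat)
    (M : market P T m) (x0 : R) : set (Omega -> R) :=
  [set X | claim M X /\ price M X = x0%:E].

(* U is only constrained on [0, +oo[; its values at negative reals are
   irrelevant. *)
Record is_utility (R : realType) (U : R -> R) : Prop := IsUtility {
  utility0 : U 0 = 0;
  utility_incr : forall x y : R, 0 <= x -> x < y -> U x < U y;
  utility_strictly_concave : forall x y t : R, 0 <= x -> 0 <= y -> x != y ->
    0 < t < 1 -> t * U x + (1 - t) * U y < U (t * x + (1 - t) * y);
  utility_derivable : forall x : R, 0 < x -> derivable U x 1;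
  utility_C1 : forall x : R, 0 < x -> {for x, continuous (derive1 U)};
  utility_inada0 : derive1 U x @[x --> 0^'+] --> +oo;
  utility_inadaoo : derive1 U x @[x --> +oo] --> 0;
  utility_elasticity :
    (limf_esup (fun x : R => (x * derive1 U x / U x)%:E) +oo%R < 1)%E
}.

(* (U')^{-1} on ]0, +oo[ *)
Definition marginal_inv (R : realType) (U : R -> R) (y : R) : R :=
  xget 0 [set x | 0 < x /\ derive1 U x = y].

(* the tangent point of x |-> U((x - d)^+), for d > 0 *)
Definition tangent_point (R : realType) (U : R -> R) (d : R) : R :=
  xget 0 [set x | d < x /\ U (x - d) / x = derive1 U (x - d)].

Definition expected_utility (R : realType) (d : measure_display)
    (Omega : measurableType d) (P : probability Omega R) (U : R -> R) (D : R)
    (X : Omega -> R) : \bar R :=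
  'E_P[(fun w => U (Num.max (X w - D) 0))%R]%E.

(* E[xi (L - X)^+] *)
Definition shortfall (R : realType) (d : measure_display)
    (Omega : measurableType d) (P : probability Omega R) (T : R) (m : nat)
    (M : market P T m) (L : R) (X : Omega -> R) : \bar R :=
  price M (fun w => Num.max (L - X w) 0).

Definition admissible (R : realType) (d : measure_display)
    (Omega : measurableType d) (P : probability Omega R) (T : R) (m : nat)
    (M : market P T m) (L eps x0 : R) (X : Omega -> R) : Prop :=
  [/\ terminal_wealths M x0 X,
      (shortfall M L X <= eps%:E)%E & (price M X <= x0%:E)%E].

Definition optimal (R : realType) (d : measure_display)
    (Omega : measurableType d) (P : probability Omega R) (T : R) (m : nat)
    (M : market P T m) (U : R -> R) (D L eps x0 : R) (X : Omega -> R) : Prop :=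
  admissible M L eps x0 X /\
  forall Y, admissible M L eps x0 Y ->
    (expected_utility P U D Y <= expected_utility P U D X)%E.

(* The Slater condition for the risk constraint.  If it fails while an
   admissible wealth exists, then x0 = E[xi L] - eps, all admissible wealths
   are bounded by L, and finite multipliers need not exist. *)
Definition slater (R : realType) (d : measure_display)
    (Omega : measurableType d) (P : probability Omega R) (T : R) (m : nat)
    (M : market P T m) (L eps x0 : R) : Prop :=
  exists2 X, terminal_wealths M x0 X & (shortfall M L X < eps%:E)%E.

Definition lagrangian (R : realType) (d : measure_display)
    (Omega : measurableType d) (P : probability Omega R) (T : R) (m : nat)
    (M : market P T m) (U : R -> R) (D L eps x0 l1 l2 : R)
    (X : Omega -> R) : \bar R :=
  (expected_utility P U D X + l1%:E * (x0%:E - price M X)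
   + l2%:E * (eps%:E - shortfall M L X))%E.

(* l1 and l2 are multipliers, at X, of the budget constraint and of the risk
   constraint; the Lagrangian is maximised over all claims of finite price. *)
Definition lagrange_multipliers (R : realType) (d : measure_display)
    (Omega : measurableType d) (P : probability Omega R) (T : R) (m : nat)
    (M : market P T m) (U : R -> R) (D L eps x0 : R) (X : Omega -> R)
    (l1 l2 : R) : Prop :=
  [/\ 0 <= l1, 0 <= l2,
      (l1%:E * (x0%:E - price M X) = 0)%E,
      (l2%:E * (eps%:E - shortfall M L X) = 0)%E &
      forall Y, claim M Y -> (price M Y < +oo)%E ->
        (lagrangian M U D L eps x0 l1 l2 Y
         <= lagrangian M U D L eps x0 l1 l2 X)%E].

(* the optimal wealth X_T^B without risk constraint, as a function of the
   multiplier lB *)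
Definition benchmark_wealth (R : realType) (Omega : Type) (xi : Omega -> R)
    (U : R -> R) (D lB : R) : Omega -> R :=
  let xiB := derive1 U (tangent_point U D - D) / lB in
  fun w => (marginal_inv U (lB * xi w) + D) * \1_[set v | xi v < xiB] w.

Definition non_redundant (R : realType) (d : measure_display)
    (Omega : measurableType d) (P : probability Omega R) (T : R) (m : nat)
    (M : market P T m) (U : R -> R) (D L eps x0 : R) : Prop :=
  exists lB, let XB := benchmark_wealth (state_price M) U D lB in
    [/\ 0 < lB, price M XB = x0%:E & (eps%:E < shortfall M L XB)%E].

(* xi_1 in the case L <= D, with the reading xi_1 = +oo for L = D. *)
Definition xi1_low (R : realType) (U : R -> R) (D L l1 : R) : \bar R :=
  if L < D then (derive1 U (tangent_point U (D - L) - (D - L)) / l1)%:E else +oo%E.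

Definition esq_low (R : realType) (Omega : Type) (xi : Omega -> R)
    (U : R -> R) (D L l1 xi2 : R) : Omega -> R :=
  let xi1 := xi1_low U D L l1 in
  fun w =>
    if (xi2%:E <= xi1)%E then
      (marginal_inv U (l1 * xi w) + D) * \1_[set v | xi v < xi2] w
    else
      (marginal_inv U (l1 * xi w) + D) * \1_[set v | ((xi v)%:E < xi1)%E] w
      + L * \1_[set v | (xi1 <= (xi v)%:E)%E /\ xi v < xi2] w.

Definition esq_mid (R : realType) (Omega : Type) (xi : Omega -> R)
    (U : R -> R) (D L l1 xi2 : R) : Omega -> R :=
  let xi1 := derive1 U (L - D) / l1 in
  fun w =>
    if xi2 < xi1 then
      (marginal_inv U (l1 * xi w) + D) * \1_[set v | xi v < xi2] w
    else
      (marginal_inv U (l1 * xi w) + D) * \1_[set v | xi v < xi1] w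
      + L * \1_[set v | xi1 <= xi v < xi2] w.

Definition esq_high (R : realType) (Omega : Type) (xi : Omega -> R)
    (U : R -> R) (D L l1 l2 : R) : Omega -> R :=
  let xi1 := derive1 U (L - D) / l1 in
  let xi2 := derive1 U (L - D) / (l1 - l2) in
  let xi3 := derive1 U (tangent_point U D - D) / (l1 - l2) in
  fun w =>
    (marginal_inv U (l1 * xi w) + D) * \1_[set v | xi v < xi1] w
    + L * \1_[set v | xi1 <= xi v < xi2] w
    + (marginal_inv U (xi w * (l1 - l2)) + D)
      * \1_[set v | xi2 <= xi v < xi3] w.

(* xi_2 in the cases L <= D and D < L <= \hat D: E[xi L 1_{xi >= xi2}] = eps *)
Definition is_xi2 (R : realType) (d : measure_display)
    (Omega : measurableType d) (P : probability Omega R) (T : R) (m : nat)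
    (M : market P T m) (L eps xi2 : R) : Prop :=
  price M (fun w => L * \1_[set v | xi2 <= state_price M v] w) = eps%:E.

Definition esq_low_params (R : realType) (d : measure_display)
    (Omega : measurableType d) (P : probability Omega R) (T : R) (m : nat)
    (M : market P T m) (U : R -> R) (D L eps x0 l1 xi2 : R) : Prop :=
  [/\ 0 < l1, is_xi2 M L eps xi2 &
      price M (esq_low (state_price M) U D L l1 xi2) = x0%:E].

Definition esq_mid_params (R : realType) (d : measure_display)
    (Omega : measurableType d) (P : probability Omega R) (T : R) (m : nat)
    (M : market P T m) (U : R -> R) (D L eps x0 l1 xi2 : R) : Prop :=
  [/\ 0 < l1, is_xi2 M L eps xi2 &
      price M (esq_mid (state_price M) U D L l1 xi2) = x0%:E].

(* l2 < l1 makes the argument xi (l1 - l2) of (U')^{-1} positive. *)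
Definition esq_high_params (R : realType) (d : measure_display)
    (Omega : measurableType d) (P : probability Omega R) (T : R) (m : nat)
    (M : market P T m) (U : R -> R) (D L eps x0 l1 l2 : R) : Prop :=
  let X := esq_high (state_price M) U D L l1 l2 in
  [/\ 0 <= l2 < l1, price M X = x0%:E & shortfall M L X = eps%:E].

(* Main.v *)
Require Import Defs.
From HB Require Import structures.
From mathcomp Require Import all_boot all_order all_algebra.
From mathcomp Require Import all_classical all_reals all_analysis.
From mathcomp Require Import measurable_realfun.
From mathcomp Require Import ring lra.

(** The Lagrangian [E[U((X - D)^+)] - l1 E[xi X] - l2 E[xi (L - X)^+]] is
    maximised state by state: where the state price is [x], one maximises its
    integrand, [score], over wealths [y >= 0].  A claim that does so and meets
    both constraints with equality is optimal, and [l1], [l2] are multipliers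
    ([multipliers_of_score], [optimal_of_multipliers]).  The comparison is one of
    integrals of nonnegative functions, so it covers infinite expected utilities.

    The building block is [floor_wealth U D L s], the maximiser of
    [U((y - D)^+) - s * y] over [y >= L].  It equals [I s + D], with [I] the
    inverse of [U'], when [s] is below a cutoff, and [L] beyond.  The cutoff is a
    tangent slope for [L < D], infinite for [L = D] and [U'(L - D)] for [L > D],
    so that the claims of cases (i) and (ii) have one expression,
    [insured_wealth]: the maximiser at [s = l1 * x] for [x < xi2], and 0 beyond.
    As [L <= Dhat], the gain [U((y - D)^+)] lies on [0, L] below its chord
    ([gain_chord]), and only 0 and this maximiser compete.  The multiplier [l2]
    is the one for which they tie at [xi2].  It is nonnegative because the risk
    constraint is not redundant: otherwise the wealth would dominate the
    benchmark wealth at the same price ([insured_threshold_ge]).  In case (iii),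
    wealth below [L] has the shadow price [(l1 - l2) * x], and the claim is
    [relaxed_wealth]: the maximiser with floor [L] for the price [l1 * x] in the
    cheap states, the one without floor for the price [(l1 - l2) * x] elsewhere.

    The parameters exist by an intermediate value argument ([integral_IVT]).
    Since [xi] has no atom, the jumps of the wealths affect null sets only, and
    prices depend continuously on multipliers.  For [l1] equal to the multiplier
    [lB] of the benchmark, the wealth dominates the benchmark wealth and differs
    from it by a bounded amount, so its price is finite and at least [x0].  When
    [l1] grows, the wealth sinks to its part below [L], whose price is
    [E[xi L] - eps], below [x0] by the Slater condition.  In case (iii) the
    shortfall is a function of [l1 - l2] alone, which is determined first. *)

Set Implicit Arguments.
Unset Strict Implicit.
Unset Printing Implicit Defensive.
Import Order.TTheory GRing.Theory Num.Theory.
Import numFieldNormedType.Exports.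
Local Open Scope classical_set_scope.
Local Open Scope ring_scope.

(** * Marginal utility and its inverse *)

Section marginal_utility.
Context (R : realType) (U : R -> R) (hU : is_utility U).
Local Notation U' := (derive1 U).
Implicit Types a b c s x y z : R.

Lemma utility_ge0 x : 0 <= x -> 0 <= U x.
Proof.
rewrite le_eqVlt => /predU1P[<-|x0]; first by rewrite (utility0 hU).
by rewrite -(utility0 hU) ltW// (utility_incr hU).
Qed.

Lemma utility_le x y : 0 <= x -> x <= y -> U x <= U y.
Proof.
move=> x0; rewrite le_eqVlt => /predU1P[->//|xy].
by rewrite ltW// (utility_incr hU).
Qed.

Lemma utility_concave x y t : 0 <= x -> 0 <= y -> 0 < t < 1 ->
  t * U x + (1 - t) * U y <= U (t * x + (1 - t) * y).
Proof.
move=> x0 y0 t01; have [->|xy] := eqVneq x y.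
  by rewrite -!mulrDl addrC subrK !mul1r.
exact/ltW/(utility_strictly_concave hU).
Qed.

(** A difference quotient of the concave [U] at [a] in the direction [z - a]
    dominates its value at step 1; letting the step tend to 0 gives the tangent.
    The point [z = 0] is included although [U] may jump there. *)
Lemma utility_le_tangent a z : 0 < a -> 0 <= z ->
  U z <= U a + U' a * (z - a).
Proof.
move=> a0 z0.
have dU : h^-1 *: (U (h *: 1 + a) - U a) @[h --> 0^'] --> U' a.
  by rewrite derive1E; exact: (utility_derivable hU a0).
have [->|za] := eqVneq z a; first by rewrite subrr mulr0 addr0.
have zar : h * (z - a) @[h --> (0:R)^'] --> (0:R)^'.
  rewrite -[X in _ --> X^'](mul0r (z - a)).
  apply: (@continuous_injective_withinNx _ _ (fun h : R => h * (z - a))).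
    exact: mulrr_continuous.
  by move=> h; rewrite mul0r => /eqP; rewrite mulf_eq0 subr_eq0 (negPf za) orbF => /eqP.
have : h^-1 * (U (a + h * (z - a)) - U a) @[h --> (0:R)^'+] --> (z - a) * U' a.
  apply: cvg_dnbhs_at_right.
  have -> : (fun h : R => h^-1 * (U (a + h * (z - a)) - U a)) =
     (fun h => (z - a) * ((h * (z - a))^-1 *: (U ((h * (z - a)) *: 1 + a) - U a))).
    apply/funext => h; rewrite /GRing.scale /= mulr1 invfM (addrC a).
    by rewrite [LHS]mulrC [RHS]mulrA (mulrCA _ h^-1) divff ?subr_eq0// mulr1 mulrC.
  apply: cvgMr.
  exact: (cvg_comp _ _ zar dU).
move=> /cvgr_to_ge; rewrite mulrC -lerBlDl; apply.
near=> h.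
have h0 : 0 < h by near: h; exact: nbhs_right_gt.
have h1 : h < 1 by near: h; exact: nbhs_right_lt.
rewrite ler_pdivlMl// lerBrDr.
apply: le_trans (_ : h * U z + (1 - h) * U a <= _); first lra.
apply: le_trans (utility_concave z0 (ltW a0) _) _; first by rewrite h0.
by rewrite le_eqVlt; apply/orP; left; apply/eqP; congr U; ring.
Unshelve. all: end_near. Qed.

Lemma utility_lt_tangent a z : 0 < a -> 0 <= z -> z != a ->
  U z < U a + U' a * (z - a).
Proof.
move=> a0 z0 za.
have h01 : (0 : R) < 2^-1 < (1 : R) by apply/andP; split; lra.
have hc := utility_strictly_concave hU z0 (ltW a0) za h01.
have m0 : 0 <= 2^-1 * z + (1 - 2^-1) * a by lra.
have := lt_le_trans hc (utility_le_tangent a0 m0).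
have -> : 2^-1 * z + (1 - 2^-1) * a - a = 2^-1 * (z - a) by lra.
by rewrite mulrCA; lra.
Qed.

Lemma marginal_gt0 a : 0 < a -> 0 < U' a.
Proof.
move=> a0.
have a1 : 0 <= a + 1 by lra.
have := utility_le_tangent a0 a1.
rewrite [a + 1 - a]addrC addKr mulr1.
have : U a < U (a + 1) by apply: (utility_incr hU); lra.
lra.
Qed.

Lemma marginal_lt a b : 0 < a -> a < b -> U' b < U' a.
Proof.
move=> a0 ab.
have b0 : 0 < b by lra.
have := utility_lt_tangent a0 (ltW b0) (negbT (gt_eqF ab)).
have := utility_lt_tangent b0 (ltW a0) (negbT (lt_eqF ab)).
move=> h1 h2.
have : U' b * (b - a) < U' a * (b - a) by lra.
by rewrite ltr_pM2r// subr_gt0.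
Qed.

Lemma marginal_ltE a b : 0 < a -> 0 < b -> (U' b < U' a) = (a < b).
Proof.
move=> a0 b0; case: (ltgtP a b) => [ab|ba|->]; last by rewrite ltxx.
- by rewrite marginal_lt.
- by apply/negbTE; rewrite -leNgt ltW// marginal_lt.
Qed.

Lemma marginal_leE a b : 0 < a -> 0 < b -> (U' b <= U' a) = (a <= b).
Proof. by move=> a0 b0; rewrite !leNgt marginal_ltE. Qed.

(** The two Inada conditions bracket [y], and [U'] is continuous in between. *)
Lemma marginal_surj y : 0 < y -> exists2 x, 0 < x & U' x = y.
Proof.
move=> y0.
have [a a0 ya] : exists2 a, 0 < a & y <= U' a.
  have /cvgryPge/(_ y) := utility_inada0 hU.
  move=> h; near (0:R)^'+ => a; exists a; near: a => //.
  exact: nbhs_right_gt.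
have [b ab yb] : exists2 b, a <= b & U' b <= y.
  have /cvgrPdist_le/(_ y y0) h := utility_inadaoo hU.
  near +oo_R => b; exists b; near: b; first by apply: nbhs_pinfty_ge; exact: num_real.
  apply: filterS h => x; rewrite sub0r normrN; apply: le_trans.
  exact: ler_norm.
have [] := @IVT R U' a b y ab.
- apply: continuous_in_subspaceT => x; rewrite inE/= in_itv/= => /andP[ax _].
  by apply: (utility_C1 hU); lra.
- by rewrite ge_min yb orbT le_max ya.
move=> c; rewrite in_itv/= => /andP[ac _] <-; exists c => //; lra.
Unshelve. all: end_near. Qed.

Local Notation I := (marginal_inv U).

Lemma marginal_invP y : 0 < y -> 0 < I y /\ U' (I y) = y.
Proof.
move=> /marginal_surj[x x0 xy].
by have := @xgetPex _ 0 [set x | 0 < x /\ U' x = y] (ex_intro _ x (conj x0 xy)).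
Qed.

Lemma marginal_inv_gt0 y : 0 < y -> 0 < I y.
Proof. by move=> /marginal_invP[]. Qed.

(** Default value of [xget]: the marginal utility is positive, so that
    no point has a nonpositive marginal utility. *)
Lemma marginal_inv0 y : y <= 0 -> I y = 0.
Proof.
move=> y0; rewrite /marginal_inv; case: xgetP => // x _ [x0 xy].
by move: (marginal_gt0 x0); rewrite xy; lra.
Qed.

Lemma marginal_inv_ge0 y : 0 <= I y.
Proof.
by have [/marginal_inv0->//|/marginal_inv_gt0/ltW] := leP y 0.
Qed.

Lemma marginal_inv_le x y : 0 < x -> x <= y -> I y <= I x.
Proof.
move=> x0 xy; have y0 : 0 < y by lra.
have [? e] := marginal_invP x0; have [? e'] := marginal_invP y0.
by rewrite -marginal_leE// e e'.
Qed.

Lemma marginal_inv_lt x y : 0 < x -> x < y -> I y < I x.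
Proof.
move=> x0 xy; have y0 : 0 < y by lra.
have [? e] := marginal_invP x0; have [? e'] := marginal_invP y0.
by rewrite -marginal_ltE// e e'.
Qed.

Lemma marginal_inv_ltE a y : 0 < a -> 0 < y -> (I y < a) = (U' a < y).
Proof.
move=> a0 y0; have [? e] := marginal_invP y0.
by rewrite -marginal_ltE// e.
Qed.

Lemma marginal_inv_gtE a y : 0 < a -> 0 < y -> (a < I y) = (y < U' a).
Proof.
move=> a0 y0; have [? e] := marginal_invP y0.
by rewrite -marginal_ltE// e.
Qed.

Lemma marginal_inv_continuous y : 0 < y -> {for y, continuous I}.
Proof.
move=> y0; have [I0 IE] := marginal_invP y0.
apply/cvgrPdist_lt => e e0.
(* [a] is a positive level between [I y - e] and [I y] *)
pose a := Num.max (I y - e) (I y / 2).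
have a0 : 0 < a by rewrite lt_max; apply/orP; right; lra.
have aI : a < I y by rewrite gt_max; apply/andP; split; lra.
have b0 : 0 < I y + e by lra.
near=> z.
have z0 : 0 < z by near: z; apply: lt_nbhsr.
have : z < U' a.
  by near: z; apply: lt_nbhsl; rewrite -marginal_inv_gtE.
rewrite -marginal_inv_gtE// gt_max => /andP[h1 _].
have : U' (I y + e) < z.
  by near: z; apply: lt_nbhsr; rewrite -marginal_inv_ltE//; lra.
rewrite -marginal_inv_ltE// => h2.
rewrite ltr_norml; apply/andP; split; lra.
Unshelve. all: end_near. Qed.

(** Optimality of the demand [I s] for the problem of maximising [U z - s * z]:
    the tangent at [I s] has slope [s]. *)
Lemma marginal_inv_max s z : 0 < s -> 0 <= z -> U z - s * z <= U (I s) - s * I s.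
Proof.
move=> s0 z0; have [I0 IE] := marginal_invP s0.
have := utility_le_tangent I0 z0; rewrite IE; lra.
Qed.

End marginal_utility.

(** * Tangent points and the demand above a floor *)

Definition gain (R : realType) (U : R -> R) (D y : R) : R := U (Num.max (y - D) 0).

(** The price level at which an agent obliged to hold at least [L] gives up
    participating above the debt [D].  For [L < D] the gain, seen from the floor,
    is that of the debt [D - L], and the level is the slope of the tangent from
    the floor; for [L = D] participating is always worth it; for [L > D] the
    level is the marginal gain at the floor. *)
Definition floor_cutoff (R : realType) (U : R -> R) (D L : R) : \bar R :=
  if L < D then (derive1 U (tangent_point U (D - L) - (D - L)))%:E
  else if L == D then +oo%E else (derive1 U (L - D))%:E.

(** The maximiser of [gain U D y - s * y] over [y >= L].  It is the common
    building block of all the optimal wealths: the benchmark wealth is the one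
    with floor 0. *)
Definition floor_wealth (R : realType) (U : R -> R) (D L s : R) : R :=
  if (s%:E < floor_cutoff U D L)%E then marginal_inv U s + D else L.

Section tangent_point.
Context (R : realType) (U : R -> R) (hU : is_utility U).
Local Notation U' := (derive1 U).
Local Notation I := (marginal_inv U).
Implicit Types a b c d s x y z : R.

(** The root of [phi z = U z - (z + d) * U' z], where [z = x - d].  Near 0 the
    term [d * U' z] explodes; at infinity it vanishes while the tangent at [z]
    bounds [U z - z * U' z] below by [U 1 - U' z]. *)
Lemma tangent_point_exists d : 0 < d ->
  exists x, d < x /\ U (x - d) / x = U' (x - d).
Proof.
move=> d0; pose phi z := U z - (z + d) * U' z.
have U1 : 0 < U 1 by rewrite -[X in X < _](utility0 hU) (utility_incr hU).
have [a [a0 a1 pa]] : exists a, [/\ 0 < a, a <= 1 & phi a <= 0].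
  have /cvgryPge/(_ (U 1 / d)) h := utility_inada0 hU.
  near (0:R)^'+ => a.
  have a0 : 0 < a by near: a; exact: nbhs_right_gt.
  have a1 : a <= 1 by near: a; exact: nbhs_right_le.
  exists a; split => //.
  have : U 1 / d <= U' a by near: a.
  rewrite ler_pdivrMr// => h1.
  have := utility_le hU (ltW a0) a1.
  have := mulr_gt0 a0 (marginal_gt0 hU a0).
  rewrite /phi; lra.
have [b b1 pb] : exists2 b, 1 <= b & 0 <= phi b.
  have e0 : 0 < U 1 / (1 + d) by rewrite divr_gt0//; lra.
  have /cvgrPdist_le/(_ _ e0) h := utility_inadaoo hU.
  near +oo_R => b; exists b.
    by near: b; apply: nbhs_pinfty_ge; exact: num_real.
  have b1 : 1 <= b by near: b; apply: nbhs_pinfty_ge; exact: num_real.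
  have b0 : 0 < b by lra.
  have : `|0 - U' b| <= U 1 / (1 + d) by near: b.
  rewrite sub0r normrN ler_pdivlMr; last lra.
  move=> h1; have h2 := ler_norm (U' b).
  have := utility_le_tangent hU b0 ler01.
  have : U' b * (1 + d) <= `|U' b| * (1 + d) by rewrite ler_wpM2r//; lra.
  rewrite /phi; lra.
have [] := @IVT R phi a b 0 (le_trans a1 b1).
- apply: continuous_in_subspaceT => x; rewrite inE/= in_itv/= => /andP[ax _].
  have x0 : 0 < x by lra.
  apply: cvgB.
    by apply: differentiable_continuous; apply/derivable1_diffP; exact: (utility_derivable hU x0).
  apply: cvgM; last exact: (utility_C1 hU x0).
  by apply: cvgD; [exact: cvg_id|exact: cvg_cst].
- by rewrite ge_min pa le_max pb orbT.
move=> c; rewrite in_itv/= => /andP[ac _] pc; exists (c + d).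
have c0 : 0 < c by lra.
rewrite addrK; split; first lra.
have -> : U c = (c + d) * U' c by move: pc; rewrite /phi; lra.
by rewrite mulrAC divff ?mul1r// gt_eqF//; lra.
Unshelve. all: end_near. Qed.

Lemma tangent_pointP d : 0 < d -> d < tangent_point U d /\
  U (tangent_point U d - d) = U' (tangent_point U d - d) * tangent_point U d.
Proof.
move=> d0; have [x hx] := tangent_point_exists d0.
have [h1 <-] := @xgetPex _ 0 [set x | d < x /\ U (x - d) / x = U' (x - d)] (ex_intro _ x hx).
by split => //; rewrite divfK// gt_eqF// (lt_trans d0 h1).
Qed.

Local Notation tslope d := (U' (tangent_point U d - d)).

Lemma tslope_gt0 d : 0 < d -> 0 < tslope d.
Proof. by move=> /tangent_pointP[? _]; apply: (marginal_gt0 hU); rewrite subr_gt0. Qed.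

(** The ray of slope [tslope d] issued from [- d] is tangent to the
    graph of [U], hence lies above it. *)
Lemma utility_le_ray d s z : 0 < d -> tslope d <= s -> 0 <= z ->
  U z <= s * (z + d).
Proof.
move=> d0 sd z0; have [dt te] := tangent_pointP d0.
have t0 : 0 < tangent_point U d - d by lra.
have := utility_le_tangent hU t0 z0; rewrite te.
have : tslope d * (z + d) <= s * (z + d) by rewrite ler_wpM2r//; lra.
lra.
Qed.

(** Below the tangent slope, a ray issued from [- d] is beaten strictly at the
    tangent point, a fortiori at the optimal demand. *)
Lemma utility_gt_ray d s : 0 < d -> 0 < s -> s < tslope d ->
  s * (I s + d) < U (I s).
Proof.
move=> d0 s0 sd; have [dt te] := tangent_pointP d0.
have t0 : 0 <= tangent_point U d - d by lra.
have := marginal_inv_max hU s0 t0; rewrite te.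
have : s * tangent_point U d < tslope d * tangent_point U d by rewrite ltr_pM2r//; lra.
lra.
Qed.

(** If the slope for the larger [d'] were not smaller, the ray of that slope
    issued from [- d] would lie above [U], and the one issued from [- d'] lies
    strictly above it: it could not touch [U]. *)
Lemma tslope_lt d d' : 0 < d -> d < d' -> tslope d' < tslope d.
Proof.
move=> d0 dd'; rewrite ltNge; apply/negP => h.
have [dt te] := tangent_pointP (lt_trans d0 dd').
have t0 : 0 <= tangent_point U d' - d' by lra.
have := utility_le_ray d0 h t0; rewrite te.
have : 0 < tslope d' * (d' - d) by rewrite mulr_gt0 ?tslope_gt0//; lra.
lra.
Qed.

End tangent_point.

Section floor_wealth.
Context (R : realType) (U : R -> R) (hU : is_utility U) (D : R) (D0 : 0 < D).
Local Notation U' := (derive1 U).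
Local Notation I := (marginal_inv U).
Local Notation cB := (U' (tangent_point U D - D)).
Implicit Types L a b c d s t x y z : R.

Lemma gain_le0 y : y <= D -> gain U D y = 0.
Proof. by move=> yD; rewrite /gain max_r ?(utility0 hU)//; lra. Qed.

Lemma gain_ge y : D <= y -> gain U D y = U (y - D).
Proof. by move=> yD; rewrite /gain max_l//; lra. Qed.

Lemma gain_ge0 y : 0 <= gain U D y.
Proof. by apply: (utility_ge0 hU); rewrite le_max lexx orbT. Qed.

Lemma gain_shift s : 0 < s -> gain U D (I s + D) = U (I s).
Proof.
by move=> s0; rewrite gain_ge ?addrK//; have := marginal_inv_gt0 hU s0; lra.
Qed.

Lemma floor_cutoff0 : floor_cutoff U D 0 = cB%:E.
Proof. by rewrite /floor_cutoff D0 subr0. Qed.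

(** Below [tangent_point U D], a floor never makes the agent give up
    earlier than without floor. *)
Lemma floor_cutoff_ge L : 0 <= L -> L <= tangent_point U D ->
  (cB%:E <= floor_cutoff U D L)%E.
Proof.
move=> L0 LT; rewrite /floor_cutoff; case: (ltgtP L D) => [LD|DL|_]; rewrite ?leey// lee_fin.
  have [->|Ln] := eqVneq L 0; first by rewrite subr0.
  by apply: ltW; apply: tslope_lt => //; lra.
by rewrite marginal_leE//; lra.
Qed.

Lemma floor_wealth0E s : floor_wealth U D 0 s = if s < cB then I s + D else 0.
Proof. by rewrite /floor_wealth floor_cutoff0 lte_fin. Qed.

Lemma floor_wealth_ge L s : 0 < s -> L <= floor_wealth U D L s.
Proof.
move=> s0; have I0 := marginal_inv_gt0 hU s0.
rewrite /floor_wealth; case: ifPn => // h.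
have [LD|DL] := leP L D; first lra.
move: h; rewrite /floor_cutoff ifF ?ifF; [|lra..]; rewrite lte_fin.
by rewrite -marginal_inv_gtE//; lra.
Qed.

Lemma floor_wealth_ge0 L s : 0 <= L -> 0 <= floor_wealth U D L s.
Proof.
move=> L0; have D1 := D0; rewrite /floor_wealth; case: ifPn => // _; have := marginal_inv_ge0 hU s; lra.
Qed.

Lemma floor_wealth_max L s y : 0 <= L -> 0 < s -> L <= y ->
  gain U D y - s * y <= gain U D (floor_wealth U D L s) - s * floor_wealth U D L s.
Proof.
move=> L0 s0 Ly.
have F z : D <= z -> gain U D z - s * z <= U (I s) - s * (I s + D).
  move=> Dz; rewrite gain_ge//.
  have z0 : 0 <= z - D by lra.
  by have := marginal_inv_max hU s0 z0; lra.
have sLy : s * L <= s * y by rewrite ler_pM2l.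
rewrite /floor_wealth; case: ifPn => h.
  rewrite gain_shift//; have [Dy|yD] := leP D y; first exact: F.
  have LD : L < D by lra.
  move: h; rewrite /floor_cutoff LD lte_fin => /(utility_gt_ray hU _ s0) h.
  rewrite gain_le0; last lra.
  have : s * (I s + (D - L)) < U (I s) by apply: h; lra.
  lra.
move: h; rewrite -leNgt /floor_cutoff; case: (ltgtP L D) => //= [LD|DL].
  rewrite lee_fin => h; rewrite (gain_le0 (ltW LD)).
  have [Dy|yD] := leP D y; last by rewrite gain_le0; lra.
  have d0 : 0 < D - L by lra.
  have y0 : 0 <= y - D by lra.
  rewrite gain_ge//; have := utility_le_ray hU d0 h y0.
  lra.
rewrite lee_fin => h; rewrite !gain_ge; [|lra..].
have a0 : 0 < L - D by lra.
have b0 : 0 <= y - D by lra.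
have := utility_le_tangent hU a0 b0.
have : U' (L - D) * (y - L) <= s * (y - L) by rewrite ler_wpM2r//; lra.
lra.
Qed.

Lemma floor_wealth_le L s t : 0 < s -> s <= t ->
  floor_wealth U D L t <= floor_wealth U D L s.
Proof.
move=> s0 st; rewrite {1}/floor_wealth; case: ifPn => h; last exact: floor_wealth_ge.
rewrite /floor_wealth (le_lt_trans _ h) ?lee_fin// lerD2r.
exact: (marginal_inv_le hU).
Qed.

Lemma floor_wealth_lt_cutoff L s : 0 <= L -> L <= tangent_point U D -> s < cB ->
  floor_wealth U D L s = I s + D.
Proof.
move=> L0 LT sB; rewrite /floor_wealth ifT//.
by apply: lt_le_trans (floor_cutoff_ge L0 LT); rewrite lte_fin.
Qed.

Lemma floor_wealth_ge_shift L s : 0 <= L -> 0 < s -> s < cB ->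
  I s + D <= floor_wealth U D L s.
Proof.
move=> L0 s0 sB; have [LT|TL] := leP L (tangent_point U D).
  by rewrite floor_wealth_lt_cutoff.
rewrite /floor_wealth; case: ifPn => //.
have [DT _] := tangent_pointP hU D0.
rewrite -leNgt /floor_cutoff ifF ?ifF; [|lra..].
rewrite lee_fin => h.
have : ~~ (L - D < I s) by rewrite marginal_inv_gtE -?leNgt//; lra.
rewrite -leNgt; lra.
Qed.

Lemma floor_wealth0_le L s : 0 <= L -> 0 < s ->
  floor_wealth U D 0 s <= floor_wealth U D L s.
Proof.
move=> L0 s0; rewrite floor_wealth0E; case: ifPn => [|_]; last exact: floor_wealth_ge0.
exact: floor_wealth_ge_shift.
Qed.

(** Up to the tangent point of [D], the slope [gain U D y / y] increases: a
    point [L] between [y] and the tangent point has, by concavity, a gain at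
    least the corresponding mean of those at [y] and at the tangent point, and
    the latter lies on the steepest ray. *)
Lemma gain_chord L y : L <= tangent_point U D -> 0 <= y -> y <= L ->
  gain U D y * L <= gain U D L * y.
Proof.
move=> LT y0 yL; have L0 : 0 <= L by lra.
have [yD|Dy] := leP y D; first by rewrite gain_le0// mul0r mulr_ge0 ?gain_ge0.
rewrite !gain_ge; [|lra..].
have [DT te] := tangent_pointP hU D0.
set t := tangent_point U D in LT DT te *.
have [->|Ly] := eqVneq y L; first by [].
(* [th] below needs [y < t] and [L < t] *)
have [->|LnT] := eqVneq L t.
  rewrite te; have yD0 : 0 <= y - D by lra.
  have := utility_le_ray hU D0 (lexx _) yD0; rewrite subrK -/t => h.
  by rewrite mulrAC ler_wpM2r//; lra.
pose th := (t - L) / (t - y).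
have ty : t - y != 0 by lra.
have th01 : 0 < th < 1.
  by rewrite divr_gt0//= ?ltr_pdivrMr; lra.
have yD0 : 0 <= y - D by lra.
have tD0 : 0 <= t - D by lra.
have := utility_concave hU yD0 tD0 th01.
have hL : L = th * y + (1 - th) * t by rewrite /th; field.
have -> : th * (y - D) + (1 - th) * (t - D) = L - D by rewrite hL; ring.
rewrite te => h.
have := utility_le_ray hU D0 (lexx _) yD0; rewrite subrK -/t => hy.
have D1 := D0; have y0' : 0 < y by lra.
have t0 : 0 < t by lra.
have h2 : (1 - th) * (U (y - D) * t) <= (1 - th) * (U' (t - D) * t * y).
  rewrite ler_wpM2l//; first lra.
  by rewrite mulrAC ler_wpM2r//; lra.
have : (th * U (y - D) + (1 - th) * (U' (t - D) * t)) * y <= U (L - D) * y by rewrite ler_wpM2r.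
apply: le_trans.
rewrite [X in _ * X <= _]hL; lra.
Qed.

(** The only possible jump is at the cutoff. *)
Lemma floor_wealth_continuous L s : 0 < s -> s%:E != floor_cutoff U D L ->
  {for s, continuous (floor_wealth U D L)}.
Proof.
move=> s0; rewrite neq_lt => /orP[h|h].
  have e : \near s, floor_wealth U D L s = I s + D.
    suff : \near s, (s%:E < floor_cutoff U D L)%E.
      by apply: filterS => t; rewrite /floor_wealth => ->.
    move: h; case: floor_cutoff => [c||] //=; rewrite ?lte_fin.
      by move=> h; near=> t; rewrite lte_fin; near: t; exact: lt_nbhsl.
    by move=> _; near=> t; exact: ltry.
  have e0 := nbhs_singleton e.
  rewrite /prop_for /continuous_at e0; apply: cvg_trans (_ : I t + D @[t --> s] --> _).
    by apply: near_eq_cvg; apply: filterS e => t /esym.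
  apply: cvgD; [exact: marginal_inv_continuous|exact: cvg_cst].
have e : \near s, floor_wealth U D L s = L.
  suff : \near s, (floor_cutoff U D L < s%:E)%E.
    by apply: filterS => t ht; rewrite /floor_wealth ltNge (ltW ht).
  move: h; case: floor_cutoff => [c||] //=; rewrite ?lte_fin.
    by move=> h; near=> t; rewrite lte_fin; near: t; exact: lt_nbhsr.
  by move=> _; near=> t; exact: ltNyr.
have e0 := nbhs_singleton e.
rewrite /prop_for /continuous_at e0; apply: cvg_trans (_ : L @[t --> s] --> _); last exact: cvg_cst.
by apply: near_eq_cvg; apply: filterS e => t /esym.
Unshelve. all: end_near. Qed.

Lemma floor_wealth_cvgy L : floor_wealth U D L s @[s --> +oo] --> L.
Proof.
have aux : \forall s \near +oo, floor_wealth U D L s = L \/ L = D.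
  have [->|LD] := eqVneq L D; first by near=> s; right.
  have [c hc] : exists c, floor_cutoff U D L = c%:E.
    by rewrite /floor_cutoff (negPf LD); case: ifPn => _; eexists.
  near=> s; left; rewrite /floor_wealth hc lte_fin ltNge ifF//.
  by apply/negbTE; rewrite negbK; near: s; apply: nbhs_pinfty_ge; exact: num_real.
apply/cvgrPdist_lt => e e0; near=> s.
have s0 : 0 < s by near: s; apply: nbhs_pinfty_gt; exact: num_real.
have Ie : I s < e.
  by rewrite marginal_inv_ltE//; near: s; apply: nbhs_pinfty_gt; exact: num_real.
have h1 := floor_wealth_ge L s0.
rewrite ler0_norm; last lra.
rewrite opprB; have [->|->] : floor_wealth U D L s = L \/ L = D by near: s.
  by rewrite subrr.
by rewrite /floor_wealth; case: ifPn => _; lra.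
Unshelve. all: end_near. Qed.

Lemma floor_wealth0_unbounded A : exists2 e, 0 < e &
  forall s, 0 < s -> s < e -> A <= floor_wealth U D 0 s.
Proof.
have A1 : 0 < Num.max A 1 by rewrite lt_max ltr01 orbT.
have D1 := D0.
exists (Num.min cB (U' (Num.max A 1))).
  by rewrite lt_min tslope_gt0// marginal_gt0.
move=> s s0; rewrite lt_min => /andP[sB]; rewrite -marginal_inv_gtE//.
by rewrite gt_max floor_wealth0E sB => /andP[? _]; lra.
Qed.

Lemma measurable_marginal_inv : measurable_fun setT I.
Proof.
rewrite (_ : setT = `]-oo, 0%R] `|` `]0%R, +oo[ :> set R); last first.
  by apply/seteqP; split => // x _ /=; rewrite !in_itv/= andbT; case: (leP x 0) => ?; [left|right].
apply/measurable_funU => //; split.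
  apply: eq_measurable_fun (@measurable_cst _ _ _ _ _ (0 : R)) => x.
  rewrite inE/= in_itv/= => x0.
  by rewrite (marginal_inv0 hU).
apply: open_continuous_measurable_fun; first exact: interval_open.
by move=> x; rewrite inE/= in_itv/= andbT => /(marginal_inv_continuous hU).
Qed.

Lemma measurable_floor_wealth L : measurable_fun setT (floor_wealth U D L).
Proof.
apply: measurable_fun_ifT => //.
  by apply: measurable_fun_lte => //; exact: measurable_EFin.
by apply: measurable_funD => //; exact: measurable_marginal_inv.
Qed.

(** [U] is continuous on the positive half-line only; below the debt the gain
    is constant, which takes care of a jump of [U] at 0. *)
Lemma measurable_gain : measurable_fun setT (gain U D).
Proof.
rewrite (_ : setT = `]-oo, D] `|` `]D, +oo[ :> set R); last first.
  by apply/seteqP; split => // x _ /=; rewrite !in_itv/= andbT; case: (leP x D) => ?; [left|right].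
apply/measurable_funU => //; split.
  apply: eq_measurable_fun (@measurable_cst _ _ _ _ _ (0 : R)) => x.
  rewrite inE/= in_itv/= => x0.
  by rewrite gain_le0.
apply: (@eq_measurable_fun _ _ R R _ (fun y : R => U (y - D))).
  by move=> x; rewrite inE/= in_itv/= andbT => /ltW/gain_ge.
apply: open_continuous_measurable_fun; first exact: interval_open.
move=> x; rewrite inE/= in_itv/= andbT => Dx.
apply: continuous_comp; first by apply: cvgB; [exact: cvg_id|exact: cvg_cst].
apply: differentiable_continuous; apply/derivable1_diffP.
by apply: (utility_derivable hU); rewrite subr_gt0.
Qed.

End floor_wealth.

(** * Pointwise maximisation of the Lagrangian *)

(** The terminal wealth, as a function of the state price [x], when [L <= Dhat]:
    the states [x < x2] are insured at level [L], in the others everything is lost. *)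
Definition insured_wealth (R : realType) (U : R -> R) (D L l x2 x : R) : R :=
  if x < x2 then floor_wealth U D L (l * x) else 0.

(** The terminal wealth when [L > Dhat].  Below [L] a unit of wealth also
    relieves the risk constraint, so that its shadow price is lowered from
    [l * x] to [mu * x]. *)
Definition relaxed_wealth (R : realType) (U : R -> R) (D L l mu x : R) : R :=
  if mu * x < derive1 U (L - D) then floor_wealth U D L (l * x)
  else floor_wealth U D 0 (mu * x).

(** The integrand of the Lagrangian, in a state of price [x] with wealth [y]. *)
Definition score (R : realType) (U : R -> R) (D L l1 l2 x y : R) : R :=
  gain U D y - l1 * (x * y) - l2 * (x * Num.max (L - y) 0).

Section pointwise.
Context (R : realType) (U : R -> R) (hU : is_utility U) (D : R) (D0 : 0 < D).
Local Notation U' := (derive1 U).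
Local Notation I := (marginal_inv U).
Local Notation cB := (U' (tangent_point U D - D)).
Implicit Types L a b c d s t x y z : R.

(** The maximal value of [gain U D y - s * y] over [y >= L]. *)
Definition floor_value L s : R :=
  gain U D (floor_wealth U D L s) - s * floor_wealth U D L s.

(** [floor_value L s / s] is a maximum over [y >= L] of the nonincreasing
    functions [gain U D y / s - y] of [s]. *)
Lemma floor_value_ratio L s t : 0 <= L -> 0 < s -> s <= t ->
  s * floor_value L t <= t * floor_value L s.
Proof.
move=> L0 s0 st; have t0 : 0 < t by lra.
have := floor_wealth_max hU D L0 s0 (floor_wealth_ge hU D L t0).
rewrite -/(floor_value L s) -(ler_pM2l t0) => /(le_trans _); apply.
rewrite /floor_value.
have : s * gain U D (floor_wealth U D L t) <= t * gain U D (floor_wealth U D L t).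
  by rewrite ler_wpM2r// (gain_ge0 hU).
lra.
Qed.

Lemma gain_le_ray y : 0 <= y -> gain U D y <= cB * y.
Proof.
move=> y0; have [yD|Dy] := leP y D.
  by rewrite gain_le0// mulr_ge0// ltW// tslope_gt0.
rewrite gain_ge; last lra.
have z0 : 0 <= y - D by lra.
by have := utility_le_ray hU D0 (lexx _) z0; rewrite subrK.
Qed.

Lemma floor_value_le0 L s : 0 <= L -> 0 < s -> cB <= s -> floor_value L s <= 0.
Proof.
move=> L0 s0 Bs; rewrite /floor_value.
have k0 := floor_wealth_ge0 hU D0 s L0.
have := gain_le_ray k0.
have : cB * floor_wealth U D L s <= s * floor_wealth U D L s by rewrite ler_wpM2r.
lra.
Qed.

(** On [y <= L] the score lies below its chord, because of [gain_chord], so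
    only the wealth 0 and the best wealth above [L] compete.  The multiplier [l2]
    makes them tie at [x2], and by [floor_value_ratio] the best wealth above [L]
    wins for smaller [x] and the wealth 0 for larger ones. *)
Lemma insured_wealth_max L l x2 x y : 0 < L -> L <= tangent_point U D ->
  0 < l -> 0 < x2 -> 0 < x -> 0 <= y ->
  let l2 := - floor_value L (l * x2) / (x2 * L) in
  score U D L l l2 x y <= score U D L l l2 x (insured_wealth U D L l x2 x).
Proof.
move=> L0 LT l0 x20 x0 y0 /=; set l2 := _ / _.
have l2E : l2 * (x2 * L) = - floor_value L (l * x2).
  by rewrite /l2 divfK// gt_eqF// mulr_gt0.
have hx2 : - l2 * (x * L) * x2 = x * floor_value L (l * x2).
  by transitivity (- x * (l2 * (x2 * L))); [ring|rewrite l2E mulrNN].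
have lx0 : 0 < l * x by rewrite mulr_gt0.
have lx20 : 0 < l * x2 by rewrite mulr_gt0.
have VM z : L <= z -> gain U D z - l * (x * z) <= floor_value L (l * x).
  by move=> Lz; rewrite mulrA; apply: floor_wealth_max => //; lra.
have ub : score U D L l l2 x y <= Num.max (floor_value L (l * x)) (- l2 * (x * L)).
  rewrite /score le_max; apply/orP.
  have [Ly|yL] := leP L y.
    by left; rewrite max_r; [have := VM y Ly; lra|lra].
  rewrite max_l; last lra.
  have hc := gain_chord hU D0 LT y0 (ltW yL).
  have hL := VM L (lexx L).
  have hL' : y * (gain U D L - l * (x * L)) <= y * floor_value L (l * x).
    by rewrite ler_wpM2l.
  case: (leP (- l2 * (x * L)) (floor_value L (l * x))) => h; [left|right];
    rewrite -(ler_pM2r L0).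
    have : (L - y) * (- l2 * (x * L)) <= (L - y) * floor_value L (l * x).
      by rewrite ler_wpM2l//; lra.
    lra.
  have : y * floor_value L (l * x) <= y * (- l2 * (x * L)) by rewrite ler_wpM2l//; lra.
  lra.
apply: le_trans ub _; rewrite /insured_wealth; case: ltP => xx2.
  have -> : score U D L l l2 x (floor_wealth U D L (l * x)) = floor_value L (l * x).
    have Lk := floor_wealth_ge hU D L lx0.
    by rewrite /score max_r ?mulr0 ?subr0 ?mulrA//; lra.
  rewrite ge_max lexx/= -(ler_pM2r x20).
  rewrite hx2.
  have lxx : l * x <= l * x2 by rewrite ler_pM2l// ltW.
  have := floor_value_ratio (ltW L0) lx0 lxx.
  by rewrite -!mulrA ler_pM2l// [x2 * _]mulrC.
have -> : score U D L l l2 x 0 = - l2 * (x * L).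
  by rewrite /score subr0 max_l ?(ltW L0)// (gain_le0 hU (ltW D0)); ring.
rewrite ge_max lexx andbT -(ler_pM2r x20).
rewrite hx2.
have lxx : l * x2 <= l * x by rewrite ler_pM2l.
have := floor_value_ratio (ltW L0) lx20 lxx.
by rewrite -!mulrA ler_pM2l// [x2 * _]mulrC.
Qed.

(** The score is at most [gain U D y - mu * x * y], up to a constant, with
    equality for [y <= L], and equals [gain U D y - l * x * y] for [y >= L].
    If the maximiser of the former stays below [L], it is the maximiser of the
    score.  Otherwise the score increases up to [L], since [L] lies beyond the
    tangent point, and the best wealth above [L] wins. *)
Lemma relaxed_wealth_max L l mu x y : tangent_point U D < L ->
  0 < mu -> mu <= l -> 0 < x -> 0 <= y ->
  score U D L l (l - mu) x y <= score U D L l (l - mu) x (relaxed_wealth U D L l mu x).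
Proof.
move=> TL mu0 mul x0 y0; have D1 := D0.
have [DT te] := tangent_pointP hU D0.
have L0 : 0 < L by lra.
have mx0 : 0 < mu * x by rewrite mulr_gt0.
have lx0 : 0 < l * x by rewrite mulr_gt0//; lra.
have scL z : L <= z -> score U D L l (l - mu) x z = gain U D z - (l * x) * z.
  by move=> Lz; rewrite /score max_r; [lra|lra].
have scl z : z <= L -> score U D L l (l - mu) x z = gain U D z - (mu * x) * z - (l - mu) * (x * L).
  by move=> Lz; rewrite /score max_l; [lra|lra].
have ub z : score U D L l (l - mu) x z <= gain U D z - (mu * x) * z - (l - mu) * (x * L).
  have [Lz|zL] := leP L z; last by rewrite scl// ltW.
  rewrite scL//; have : (l - mu) * x * L <= (l - mu) * x * z.
    by rewrite ler_wpM2l// mulr_ge0//; lra.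
  lra.
rewrite /relaxed_wealth; case: ifPn => h.
  have VM z : L <= z -> score U D L l (l - mu) x z <= score U D L l (l - mu) x (floor_wealth U D L (l * x)).
    move=> Lz; rewrite !scL//; last exact: floor_wealth_ge.
    by apply: floor_wealth_max => //; lra.
  have [Ly|yL] := leP L y; first exact: VM.
  apply: le_trans (VM L (lexx L)).
  rewrite !scl//; last exact: ltW.
  rewrite lerD2r.
  have a0 : 0 < L - D by lra.
  have t0 : 0 <= tangent_point U D - D by lra.
  have hsl : mu * x * (L - y) <= U' (L - D) * (L - y) by rewrite ler_wpM2r//; lra.
  suff : gain U D y <= gain U D L + U' (L - D) * (y - L) by lra.
  rewrite (gain_ge U (ltW (lt_trans DT TL))).
  have [Dy|yD] := leP D y.
    rewrite gain_ge//; have z0 : 0 <= y - D by lra.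
    by have := utility_le_tangent hU a0 z0; lra.
  rewrite gain_le0; [|exact: hU|exact: ltW].
  (* below [D] the gain vanishes: the tangent at [L] has to be nonnegative at 0,
     which it is since it is flatter than the tangent ray issued from 0 *)
  have := utility_le_tangent hU a0 t0; rewrite te.
  have c0 : 0 < U' (L - D) by apply: marginal_gt0.
  have : U' (L - D) * tangent_point U D <= cB * tangent_point U D.
    by rewrite ler_wpM2r//; [lra|rewrite marginal_leE//; lra].
  have : 0 <= U' (L - D) * y by rewrite mulr_ge0// ltW.
  lra.
apply: le_trans (ub y) _.
have kL : floor_wealth U D 0 (mu * x) <= L.
  rewrite floor_wealth0E//; case: ifPn => _; last lra.
  move: h; rewrite -leNgt => h.
  have : ~~ (L - D < I (mu * x)) by rewrite marginal_inv_gtE// -?leNgt//; lra.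
  by rewrite -leNgt; lra.
rewrite scl// lerD2r.
by apply: floor_wealth_max.
Qed.

End pointwise.

(** * The optimal claims as functions of the state price *)

Lemma indic_natr (R : realType) (T : Type) (S : set T) (w : T) (b : bool) :
  S w <-> b -> \1_S w = b%:R :> R.
Proof. by move=> Sb; rewrite indicE; congr (nat_of_bool _)%:R; apply/idP/idP; rewrite inE => /Sb. Qed.

Section esq_insured.
Context (R : realType) (U : R -> R) (hU : is_utility U) (D : R) (D0 : 0 < D).
Context (Omega : Type) (xi : Omega -> R).
Local Notation U' := (derive1 U).
Local Notation cB := (U' (tangent_point U D - D)).
Implicit Types L l : R.

Lemma floor_cutoff_low L l1 x : L <= D -> 0 < l1 ->
  ((l1 * x)%:E < floor_cutoff U D L)%E = (x%:E < xi1_low U D L l1)%E.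
Proof.
move=> LD l10; rewrite /floor_cutoff /xi1_low; move: LD; rewrite le_eqVlt.
move=> /predU1P[->|LD]; first by rewrite ltxx eqxx !ltry.
by rewrite LD !lte_fin ltr_pdivlMr// mulrC.
Qed.

Lemma floor_cutoff_mid L l1 x : D < L -> 0 < l1 ->
  ((l1 * x)%:E < floor_cutoff U D L)%E = (x < U' (L - D) / l1).
Proof.
move=> DL l10; rewrite /floor_cutoff ifF ?ifF; [|lra..].
by rewrite lte_fin ltr_pdivlMr// mulrC.
Qed.

Lemma esq_lowE L l1 x2 : L <= D -> 0 < l1 ->
  esq_low xi U D L l1 x2 = (fun w => insured_wealth U D L l1 x2 (xi w)).
Proof.
move=> LD l10; apply/funext => w.
rewrite /esq_low /insured_wealth /floor_wealth floor_cutoff_low//.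
set x1 := xi1_low _ _ _ _.
have -> : \1_[set v | xi v < x2] w = (xi w < x2)%R%:R :> R by exact: indic_natr.
have -> : \1_[set v | ((xi v)%:E < x1)%E] w = ((xi w)%:E < x1)%E%:R :> R by exact: indic_natr.
have -> : \1_[set v | (x1 <= (xi v)%:E)%E /\ xi v < x2] w =
    ((x1 <= (xi w)%:E)%E && (xi w < x2)%R)%:R :> R.
  by apply: indic_natr; exact: (rwP andP).
case: ifPn => [h|]; [|rewrite -ltNge => h].
  have [wx2|_] := ltP (xi w) x2; last by rewrite mulr0.
  by rewrite mulr1 (lt_le_trans _ h)// lte_fin.
rewrite leNgt; case: ifPn => [wx2|wx2].
  by case: ifPn => _; rewrite /= ?mulr1 ?mulr0 ?addr0 ?add0r.
rewrite andbF mulr0 addr0; have -> : ((xi w)%:E < x1)%E = false.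
  by apply/negbTE; rewrite -leNgt (le_trans (ltW h))// lee_fin leNgt.
by rewrite mulr0.
Qed.

Lemma esq_midE L l1 x2 : D < L -> 0 < l1 ->
  esq_mid xi U D L l1 x2 = (fun w => insured_wealth U D L l1 x2 (xi w)).
Proof.
move=> DL l10; apply/funext => w.
rewrite /esq_mid /insured_wealth /floor_wealth floor_cutoff_mid//.
set x1 := U' (L - D) / l1.
have -> : \1_[set v | xi v < x2] w = (xi w < x2)%R%:R :> R by exact: indic_natr.
have -> : \1_[set v | xi v < x1] w = (xi w < x1)%R%:R :> R by exact: indic_natr.
have -> : \1_[set v | x1 <= xi v < x2] w = (x1 <= xi w < x2)%R%:R :> R by exact: indic_natr.
case: (ltP x2 x1) => h.
  have [wx2|_] := ltP (xi w) x2; last by rewrite mulr0.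
  by rewrite mulr1 (lt_trans wx2 h).
rewrite leNgt; case: (ltP (xi w) x2) => wx2.
  by case: ifPn => _; rewrite /= ?mulr1 ?mulr0 ?addr0 ?add0r.
rewrite andbF mulr0 addr0; have -> : (xi w < x1) = false.
  by apply/negbTE; rewrite -leNgt (le_trans h).
by rewrite mulr0.
Qed.

Lemma esq_highE L l1 l2 : tangent_point U D < L -> 0 <= l2 -> l2 < l1 ->
  esq_high xi U D L l1 l2 = (fun w => relaxed_wealth U D L l1 (l1 - l2) (xi w)).
Proof.
move=> TL l20 l21; apply/funext => w.
have D1 := D0; have [DT te] := tangent_pointP hU D0.
have DL : D < L by lra.
have l10 : 0 < l1 by lra.
have mu0 : 0 < l1 - l2 by lra.
have c0 : 0 < U' (L - D) by apply: marginal_gt0 => //; lra.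
have cc : U' (L - D) < cB by rewrite marginal_ltE//; lra.
rewrite /esq_high /relaxed_wealth floor_wealth0E// /floor_wealth.
rewrite floor_cutoff_mid//.
rewrite [(l1 - l2) * _]mulrC -!ltr_pdivlMr//.
have x12 : U' (L - D) / l1 <= U' (L - D) / (l1 - l2).
  by rewrite ler_pM2l// lef_pV2 ?posrE//; lra.
have x23 : U' (L - D) / (l1 - l2) < cB / (l1 - l2) by rewrite ltr_pM2r// invr_gt0.
set x1 := U' (L - D) / l1 in x12 *.
set x2 := U' (L - D) / (l1 - l2) in x12 x23 *.
set x3 := cB / (l1 - l2) in x23 *.
have -> : \1_[set v | xi v < x1] w = (xi w < x1)%R%:R :> R by exact: indic_natr.
have -> : \1_[set v | x1 <= xi v < x2] w = (x1 <= xi w < x2)%R%:R :> R by exact: indic_natr.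
have -> : \1_[set v | x2 <= xi v < x3] w = (x2 <= xi w < x3)%R%:R :> R by exact: indic_natr.
have [w1|w1] := ltP (xi w) x1.
  have w2 := lt_le_trans w1 x12.
  by rewrite w2 leNgt w2/= !mulr0 mulr1 !addr0.
have [w2|w2] /= := ltP (xi w) x2.
  by rewrite !mulr0 mulr1 add0r addr0.
by rewrite !mulr0 !add0r; case: ifPn => _; rewrite ?mulr1 ?mulr0.
Qed.

Lemma benchmark_wealthE l : 0 < l ->
  benchmark_wealth xi U D l = (fun w => floor_wealth U D 0 (l * xi w)).
Proof.
move=> l0; apply/funext => w; rewrite /benchmark_wealth floor_wealth0E//.
rewrite (@indic_natr _ _ _ _ (xi w < cB / l))// ltr_pdivlMr// [xi w * _]mulrC.
by case: ifPn => _; rewrite ?mulr1 ?mulr0.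
Qed.

End esq_insured.

(** * An intermediate value theorem for integrals *)

(** Dominated convergence makes the integral a continuous function of the
    parameter [l] on the half-line from [a] on.  The parameter is clamped at [a]
    because the domination by [f a] only holds above [a]. *)
Lemma integral_IVT (d : measure_display) (T : measurableType d) (R : realType)
    (mu : {measure set T -> \bar R}) (f : R -> T -> R) (g : T -> R) (a v : R) :
  (forall l, measurable_fun setT (f l)) -> measurable_fun setT g ->
  (forall l w, a <= l -> 0 <= f l w <= f a w) ->
  (\int[mu]_w (f a w)%:E < +oo)%E ->
  (forall l, a <= l -> {ae mu, forall w, {for l, continuous (f ^~ w)}}) ->
  {ae mu, forall w, f l w @[l --> +oo] --> g w} ->
  (\int[mu]_w (g w)%:E < v%:E)%E -> (v%:E <= \int[mu]_w (f a w)%:E)%E ->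
  exists2 l, a <= l & (\int[mu]_w (f l w)%:E = v%:E)%E.
Proof.
move=> mf mg fle fa_fin fc fg gv vf.
have fa0 w : 0 <= f a w by have /andP[] := fle a w (lexx a).
have ifa : mu.-integrable setT (EFin \o f a).
  apply/integrableP; split; first exact/measurable_EFinP.
  by under eq_integral do rewrite /= ger0_norm//.
have DC (u : nat -> R) (h : T -> R) : (forall n, a <= u n) -> measurable_fun setT h ->
    {ae mu, forall w, f (u n) w @[n --> \oo] --> h w} ->
    mu.-integrable setT (EFin \o h) /\
    (\int[mu]_w (f (u n) w)%:E)%E @[n --> \oo] --> (\int[mu]_w (h w)%:E)%E.
  move=> ua mh uh.
  have [] := @dominated_convergence _ _ _ mu setT measurableT
    (fun n => EFin \o f (u n)) (EFin \o h) (EFin \o f a).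
  - by move=> n; exact/measurable_EFinP.
  - exact/measurable_EFinP.
  - by apply: filterS uh => w hw _; apply: cvg_EFin => //; exact: nearW.
  - exact: ifa.
  - apply: aeW => w n _ /=; have /andP[h0 h1] := fle _ w (ua n).
    by rewrite lee_fin ger0_norm.
  by move=> ih _ c; split.
pose F l := fine (\int[mu]_w (f (Num.max l a) w)%:E).
have maxa l : a <= Num.max l a by rewrite le_max lexx orbT.
have fin l : a <= l -> (\int[mu]_w (f l w)%:E)%E \is a fin_num.
  move=> al; have [|ih _] := DC (fun=> l) (f l) (fun=> al) (mf l).
    by apply: aeW => w; exact: cvg_cst.
  exact: integrable_fin_num.
have Fc : continuous F.
  move=> l; apply/(@cvg_nbhsP _ R^o) => u ul.
  have [|_] := DC (fun n => Num.max (u n) a) (f (Num.max l a)) (fun n => maxa (u n)) (mf _).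
    apply: filterS (fc _ (maxa l)) => w hw.
    apply: (@cvg_comp _ _ _ (fun n => Num.max (u n) a) (f ^~ w) _ _ _ _ hw).
    have cm : {for l, continuous (idfun \max cst a : R -> R^o)}.
      by apply: continuous_max; [exact: cvg_id|exact: cvg_cst].
    exact: (cvg_comp _ _ ul cm).
  by rewrite -{1}(fineK (fin _ (maxa l))) => /fine_cvg.
have [b ab Fb] : exists2 b, a <= b & F b < v.
  pose u n : R := Num.max n%:R a.
  have uoo : u n @[n --> \oo] --> +oo.
    by apply: ger_cvgy cvgr_idn; near=> n; rewrite /u le_max lexx.
  have [|ig] := DC u g (fun n => maxa n%:R) mg.
    apply: filterS fg => w hw.
    exact: (@cvg_comp _ _ _ u (f ^~ w) _ _ _ uoo hw).
  have gfin : (\int[mu]_w (g w)%:E)%E \is a fin_num by exact: integrable_fin_num.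
  rewrite -{1}(fineK gfin) => /fine_cvg.
  have : fine (\int[mu]_w (g w)%:E) < v by rewrite -lte_fin fineK.
  move=> gv' /(cvgr_lt _)/(_ _ gv') [N _ /(_ N (leqnn N))] /= hN.
  exists (u N); first exact: maxa.
  by rewrite /F (max_l (maxa N%:R)).
have [|c] := @IVT R F a b v ab (continuous_subspaceT Fc).
  rewrite ge_min le_max (ltW Fb) orbT/=; apply/orP; left.
  by rewrite /F maxxx -lee_fin fineK// fin.
rewrite in_itv/= => /andP[ac _] Fcv; exists c => //.
by rewrite -Fcv /F max_l// fineK// fin.
Unshelve. all: end_near. Qed.

(** * Prices, shortfalls and Lagrangians in the market *)

Lemma real_integralD (d : measure_display) (T : measurableType d) (R : realType)
    (mu : {measure set T -> \bar R}) (f g : T -> R) :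
  (forall w, 0 <= f w) -> (forall w, 0 <= g w) ->
  measurable_fun setT f -> measurable_fun setT g ->
  (\int[mu]_w (f w + g w)%:E = \int[mu]_w (f w)%:E + \int[mu]_w (g w)%:E)%E.
Proof.
move=> f0 g0 mf mg; under eq_integral do rewrite EFinD.
by apply: ge0_integralD => //; [move=> ? _; exact: f0|exact/measurable_EFinP
  |move=> ? _; exact: g0|exact/measurable_EFinP].
Qed.

Lemma real_integralZ (d : measure_display) (T : measurableType d) (R : realType)
    (mu : {measure set T -> \bar R}) (f : T -> R) (a : R) :
  (forall w, 0 <= f w) -> 0 <= a -> measurable_fun setT f ->
  (\int[mu]_w (a * f w)%:E = a%:E * \int[mu]_w (f w)%:E)%E.
Proof.
move=> f0 a0 mf; under eq_integral do rewrite EFinM.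
by apply: ge0_integralZl_EFin => //; [move=> ? _; exact: f0|exact/measurable_EFinP].
Qed.

Lemma real_integral_le (d : measure_display) (T : measurableType d) (R : realType)
    (mu : {measure set T -> \bar R}) (f g : T -> R) :
  (forall w, 0 <= f w) -> measurable_fun setT f -> measurable_fun setT g ->
  (forall w, f w <= g w) ->
  (\int[mu]_w (f w)%:E <= \int[mu]_w (g w)%:E)%E.
Proof.
move=> f0 mf mg fg.
apply: ge0_le_integral => //.
- by move=> ? _; exact: f0.
- exact/measurable_EFinP.
- exact/measurable_EFinP.
- by move=> w _; rewrite lee_fin.
Qed.

Lemma measurable_inv (R : realType) : measurable_fun setT (fun x : R => x^-1).
Proof.
rewrite (_ : setT = [set 0] `|` [set~ 0] :> set R); last by rewrite setUv.
apply/measurable_funU; [exact: measurable_set1|by apply: measurableC; exact: measurable_set1|].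
split; first exact: measurable_fun_set1.
apply: open_continuous_measurable_fun; last first.
  by move=> x; rewrite inE/= => /eqP x0; exact: inv_continuous.
by apply: closed_openC; apply: accessible_closed_set1; exact: hausdorff_accessible.
Qed.

Section market.
Context (R : realType) (d : measure_display) (Omega : measurableType d).
Context (P : probability Omega R) (T : R) (m : nat) (M : market P T m).
Local Notation xi := (state_price M).

Let T0 : 0 <= (0 : R) <= T. Proof. by rewrite lexx ltW// (horizon_gt0 M). Qed.
Let TT : 0 <= T <= T. Proof. by rewrite lexx ltW// (horizon_gt0 M). Qed.

Lemma state_price_ge0 w : 0 <= xi w.
Proof.
rewrite /state_price mulr_ge0 ?(dQdP_ge0 M)//.
by rewrite divr_ge0// ltW//; apply: bond_gt0.
Qed.

(** The measurability of the product is that of functions on the space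
    [Omega] equipped with the sigma-algebra [filt M T]. *)
Lemma state_price_measurable_wrt : measurable_wrt (filt M T) xi.
Proof.
have sE : <<s filt M T >> = filt M T by exact: (sigma_algebra_id (filt_sigma_algebra M TT)).
pose G := g_sigma_algebraType (filt M T).
have mG (X : Omega -> R) : measurable_wrt (filt M T) X <-> measurable_fun setT (X : G -> R).
  split=> [mX _ B mB|mX B mB].
    by rewrite setTI /measurable/= /g_sigma_algebraType sE; exact: mX.
  have := mX measurableT B mB; rewrite setTI.
  by rewrite /measurable/= sE.
apply/mG; apply: (@measurable_funM _ G).
  apply: (@measurable_funM _ G).
    apply/mG => B mB; have T0' : 0 <= T by case/andP: TT.
    exact: (filt_mono (lexx _) T0' (lexx _) (bond_adapted M T0 mB)).
  apply: (@measurableT_comp _ _ _ G _ _ (fun x : R => x^-1)).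
    exact: measurable_inv.
  exact/mG/(bond_adapted M TT).
exact/mG/(dQdP_measurable M).
Qed.

Lemma measurable_wrt_fun (X : Omega -> R) : measurable_wrt (filt M T) X -> measurable_fun setT X.
Proof. by move=> mX _ B mB; rewrite setTI; apply: (filt_measurable TT); exact: mX. Qed.

Lemma measurable_state_price : measurable_fun setT xi.
Proof. exact: measurable_wrt_fun state_price_measurable_wrt. Qed.

Lemma measurable_pay (k : R -> R) : measurable_fun setT k ->
  measurable_fun setT (fun w => xi w * k (xi w)).
Proof.
move=> mk; apply: measurable_funM; first exact: measurable_state_price.
by apply: measurableT_comp => //; exact: measurable_state_price.
Qed.

Lemma priceE X : price M X = (\int[P]_w (xi w * X w)%:E)%E.
Proof. by rewrite /price unlock. Qed.

(** States of zero price are worth nothing, whatever the wealth there. *)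
Lemma eq_price X Y : (forall w, 0 < xi w -> X w = Y w) -> price M X = price M Y.
Proof.
move=> XY; rewrite !priceE; apply: eq_integral => w _; congr (_%:E).
have := state_price_ge0 w; rewrite le_eqVlt => /predU1P[<-|w0].
  by rewrite !mul0r.
by rewrite XY.
Qed.

(** Replicability is the completeness of the market. *)
Lemma claim_of_state_price (k : R -> R) : measurable_fun setT k ->
  (forall x, 0 <= x -> 0 <= k x) -> (price M (k \o xi) < +oo)%E -> claim M (k \o xi).
Proof.
move=> mk k0 pk.
have kw w : 0 <= (k \o xi) w by apply: k0; exact: state_price_ge0.
have mX : measurable_wrt (filt M T) (k \o xi).
  move=> B mB; rewrite comp_preimage; apply: state_price_measurable_wrt.
  by rewrite -[_ @^-1` _]setTI; exact: mk.
split => //.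
by have [V [hV VX _]] := complete mX kw pk; exists V.
Qed.

Hypothesis hatomless : atomless_rv P xi.

Lemma ae_state_price_neq c : {ae P, forall w, xi w != c}.
Proof.
exists (xi @^-1` [set c]); split.
- rewrite -[X in measurable X]setTI; apply: measurable_state_price => //.
- exact: hatomless.
- by move=> w /= /negP; rewrite negbK => /eqP.
Qed.

Lemma ae_state_price_gt0 : {ae P, forall w, 0 < xi w}.
Proof.
by apply: filterS (ae_state_price_neq 0) => w; rewrite lt_neqAle state_price_ge0 eq_sym andbT.
Qed.

Context (U : R -> R) (hU : is_utility U) (D L eps x0 : R).
Hypotheses (D0 : 0 < D) (L0 : 0 < L) (eps0 : 0 < eps).

(** [L <= X + (L - X)^+]. *)
Lemma price_bound X e : claim M X -> price M X = x0%:E -> (shortfall M L X <= e)%E ->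
  (price M (cst L) <= x0%:E + e)%E.
Proof.
move=> [mX _ X0] pX sX; rewrite -pX; apply: le_trans (leeD2l _ sX).
rewrite /shortfall !priceE -real_integralD.
- apply: real_integral_le => [w|||w].
  + by rewrite mulr_ge0 ?state_price_ge0 ?ltW.
  + by apply: measurable_funM => //; exact: measurable_state_price.
  + apply: measurable_funD; apply: measurable_funM; try exact: measurable_state_price.
      exact: measurable_wrt_fun.
    apply: measurable_funrpos; apply: measurable_funB => //; exact: measurable_wrt_fun.
  + rewrite -mulrDr ler_wpM2l ?state_price_ge0//= -lerBlDl le_max lexx//.
- by move=> w; rewrite mulr_ge0 ?state_price_ge0.
- by move=> w; rewrite mulr_ge0 ?state_price_ge0// le_max lexx orbT.
- apply: measurable_funM; first exact: measurable_state_price.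
  exact: measurable_wrt_fun.
- apply: measurable_funM; first exact: measurable_state_price.
  apply: measurable_funrpos; apply: measurable_funB => //; exact: measurable_wrt_fun.
Qed.

Hypothesis xi_fin : (\int[P]_w (xi w)%:E < +oo)%E.

Lemma measurable_claim X : claim M X -> measurable_fun setT X.
Proof. by case=> /measurable_wrt_fun. Qed.

Lemma measurable_pos_part (c : R) (X : Omega -> R) : measurable_fun setT X ->
  measurable_fun setT (fun w => xi w * Num.max (c - X w) 0).
Proof.
move=> mX; apply: measurable_funM; first exact: measurable_state_price.
by apply: measurable_funrpos; exact: measurable_funB.
Qed.

Lemma pos_part_ge0 (c : R) (X : Omega -> R) w : 0 <= xi w * Num.max (c - X w) 0.
Proof. by rewrite mulr_ge0 ?state_price_ge0// le_max lexx orbT. Qed.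

Lemma shortfallE X : shortfall M L X = (\int[P]_w (xi w * Num.max (L - X w) 0)%:E)%E.
Proof. exact: priceE. Qed.

Lemma expected_utilityE X : expected_utility P U D X = (\int[P]_w (gain U D (X w))%:E)%E.
Proof. by rewrite /expected_utility unlock. Qed.

Lemma price_cst c : 0 <= c -> price M (cst c) = (c%:E * \int[P]_w (xi w)%:E)%E.
Proof.
move=> c0; rewrite priceE -real_integralZ//; last exact: measurable_state_price.
- by apply: eq_integral => w _; rewrite mulrC.
- exact: state_price_ge0.
Qed.

Lemma price_cst_fin c : 0 <= c -> (price M (cst c) < +oo)%E.
Proof. by move=> c0; rewrite price_cst// lte_mul_pinfty. Qed.

Lemma price_ge0 X : claim M X -> (0 <= price M X)%E.
Proof.
move=> [_ _ X0]; rewrite priceE; apply: integral_ge0 => w _.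
by rewrite lee_fin mulr_ge0// state_price_ge0.
Qed.

Lemma shortfall_fin X : claim M X -> shortfall M L X \is a fin_num.
Proof.
move=> cX; rewrite shortfallE ge0_fin_numE; last first.
  by apply: integral_ge0 => w _; rewrite lee_fin pos_part_ge0.
have mX := measurable_claim cX; case: cX => _ _ X0.
apply: le_lt_trans (price_cst_fin (ltW L0)); rewrite priceE.
apply: real_integral_le => [w|||w].
- exact: pos_part_ge0.
- exact: measurable_pos_part.
- by apply: measurable_funM => //; exact: measurable_state_price.
- rewrite ler_wpM2l ?state_price_ge0// ge_max/= (ltW L0) andbT.
  by have := X0 w; lra.
Qed.

(** The inequality between the Lagrangians, with the negative terms moved to
    the other side: all the integrands are nonnegative, so that it makes sense
    even if expected utilities are infinite. *)
Lemma lagrangian_le (X Y : Omega -> R) l1 l2 :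
  claim M X -> claim M Y -> 0 <= l1 -> 0 <= l2 ->
  (forall w, 0 < xi w -> score U D L l1 l2 (xi w) (Y w) <= score U D L l1 l2 (xi w) (X w)) ->
  (expected_utility P U D Y + (l1%:E * price M X + l2%:E * shortfall M L X) <=
   expected_utility P U D X + (l1%:E * price M Y + l2%:E * shortfall M L Y))%E.
Proof.
move=> cX cY l10 l20 le.
have mg (Z : Omega -> R) : claim M Z -> measurable_fun setT (fun w => gain U D (Z w)).
  move=> /measurable_claim mZ.
  by apply: (@measurableT_comp _ _ _ _ _ _ (gain U D)) => //; exact: measurable_gain.
have mp (Z : Omega -> R) : claim M Z -> measurable_fun setT (fun w => xi w * Z w).
  by move=> /measurable_claim mZ; apply: measurable_funM => //; exact: measurable_state_price.
have ms (Z : Omega -> R) : claim M Z -> measurable_fun setT (fun w => xi w * Num.max (L - Z w) 0).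
  by move=> /measurable_claim mZ; exact: measurable_pos_part.
have p0 (Z : Omega -> R) w : claim M Z -> 0 <= xi w * Z w.
  by move=> [_ _ Z0]; rewrite mulr_ge0 ?state_price_ge0.
have sumE (Z Z' : Omega -> R) : claim M Z -> claim M Z' ->
  (expected_utility P U D Z + (l1%:E * price M Z' + l2%:E * shortfall M L Z') =
   \int[P]_w (gain U D (Z w) + (l1 * (xi w * Z' w) + l2 * (xi w * Num.max (L - Z' w) 0)))%:E)%E.
  move=> cZ cZ'.
  have m1 : measurable_fun setT (fun w => l1 * (xi w * Z' w)) by apply: measurable_funM => //; exact: mp.
  have m2 : measurable_fun setT (fun w => l2 * (xi w * Num.max (L - Z' w) 0)).
    by apply: measurable_funM => //; exact: ms.
  rewrite expected_utilityE shortfallE priceE -!real_integralZ//.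
  - rewrite -real_integralD//.
    rewrite -real_integralD//.
    + by move=> w; exact: gain_ge0.
    + by move=> w; rewrite addr_ge0// mulr_ge0// ?p0// pos_part_ge0.
    + exact: mg.
    + exact: measurable_funD.
    + by move=> w; rewrite mulr_ge0// p0.
    + by move=> w; rewrite mulr_ge0// pos_part_ge0.
  - by move=> w; exact: pos_part_ge0.
  - exact: ms.
  - by move=> w; exact: p0.
  - exact: mp.
rewrite !sumE//; apply: ae_ge0_le_integral => //.
- move=> w _; rewrite lee_fin addr_ge0 ?(gain_ge0 hU)//.
  by rewrite addr_ge0// mulr_ge0// ?p0// pos_part_ge0.
- apply/measurable_EFinP; apply: measurable_funD; first exact: mg.
  by apply: measurable_funD; apply: measurable_funM => //; [exact: mp|exact: ms].
- move=> w _; rewrite lee_fin addr_ge0 ?(gain_ge0 hU)//.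
  by rewrite addr_ge0// mulr_ge0// ?p0// pos_part_ge0.
- apply/measurable_EFinP; apply: measurable_funD; first exact: mg.
  by apply: measurable_funD; apply: measurable_funM => //; [exact: mp|exact: ms].
- apply: filterS ae_state_price_gt0 => w w0 _; rewrite lee_fin.
  by have := le w w0; rewrite /score; lra.
Qed.

Lemma multipliers_of_score (X : Omega -> R) l1 l2 :
  claim M X -> 0 <= l1 -> 0 <= l2 ->
  price M X = x0%:E -> shortfall M L X = eps%:E ->
  (forall w y, 0 < xi w -> 0 <= y ->
    score U D L l1 l2 (xi w) y <= score U D L l1 l2 (xi w) (X w)) ->
  lagrange_multipliers M U D L eps x0 X l1 l2.
Proof.
move=> cX l10 l20 pX sX le.
split => //; rewrite ?pX ?sX ?subee ?mule0//.
move=> Y cY pY.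
have := lagrangian_le cX cY l10 l20 (fun w w0 => le w _ w0 (let: And3 _ _ Y0 := cY in Y0 w)).
rewrite /lagrangian pX sX !subee// !mule0 !adde0.
have EU0 Z : (0 <= expected_utility P U D Z)%E.
  by rewrite expected_utilityE; apply: integral_ge0 => w _; rewrite lee_fin; exact: gain_ge0.
have := EU0 X; have := EU0 Y.
have pYf : price M Y \is a fin_num by rewrite ge0_fin_numE// price_ge0.
rewrite -(fineK pYf) -(fineK (shortfall_fin cY)).
case: (expected_utility P U D X) => [a||]; rewrite ?leey//.
case: (expected_utility P U D Y) => [b||]; rewrite ?leNye// => _ _.
rewrite -!EFinB -!EFinM -!EFinD !lee_fin; lra.
Qed.

Lemma optimal_of_multipliers X l1 l2 : claim M X ->
  price M X = x0%:E -> shortfall M L X = eps%:E ->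
  lagrange_multipliers M U D L eps x0 X l1 l2 -> optimal M U D L eps x0 X.
Proof.
move=> cX pX sX [l10 l20 _ _ LX]; split.
  by split; [split|rewrite sX|rewrite pX].
move=> Y [[cY pY] sY _].
have := LX Y cY; rewrite pY ltry => /(_ isT).
rewrite /lagrangian pX pY sX !subee// !mule0 !adde0; apply: le_trans.
by rewrite leeDl// mule_ge0 ?lee_fin// subre_ge0.
Qed.

End market.

(** * Optimality of the claims and existence of the parameters *)

Section esq.
Context (R : realType) (d : measure_display) (Omega : measurableType d).
Context (P : probability Omega R) (T : R) (m : nat) (M : market P T m).
Local Notation xi := (state_price M).
Context (U : R -> R) (hU : is_utility U) (D L eps x0 : R).
Hypotheses (hatomless : atomless_rv P xi).
Hypotheses (D0 : 0 < D) (L0 : 0 < L) (eps0 : 0 < eps) (x00 : 0 < x0).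
Hypothesis xi_fin : (\int[P]_w (xi w)%:E < +oo)%E.
Local Notation U' := (derive1 U).
Local Notation I := (marginal_inv U).
Local Notation cB := (U' (tangent_point U D - D)).
Local Notation xi_ge0 := (state_price_ge0 M).
Local Notation mxi := (measurable_state_price M).

Lemma price_le (k h : R -> R) : measurable_fun setT k -> measurable_fun setT h ->
  (forall x, 0 < x -> 0 <= k x <= h x) ->
  (price M (k \o xi) <= price M (h \o xi))%E.
Proof.
move=> mk mh kh; rewrite !priceE.
apply: real_integral_le => [w|||w]; try exact: measurable_pay.
  have := xi_ge0 w; rewrite le_eqVlt => /predU1P[<-|w0]; first by rewrite mul0r.
  by rewrite mulr_ge0 ?xi_ge0//=; have /andP[] := kh _ w0.
have := xi_ge0 w; rewrite le_eqVlt => /predU1P[<-|w0]; first by rewrite !mul0r.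
by rewrite ler_pM2l//; have /andP[] := kh _ w0.
Qed.

Lemma price_add (k h : R -> R) : measurable_fun setT k -> measurable_fun setT h ->
  (forall x, 0 < x -> 0 <= k x) -> (forall x, 0 < x -> 0 <= h x) ->
  (price M ((fun x => k x + h x)%R \o xi) = price M (k \o xi) + price M (h \o xi))%E.
Proof.
move=> mk mh k0 h0; rewrite !priceE.
have nn (f : R -> R) w : (forall x, 0 < x -> 0 <= f x) -> 0 <= xi w * f (xi w).
  move=> f0; have := xi_ge0 w; rewrite le_eqVlt => /predU1P[<-|w0]; first by rewrite mul0r.
  by rewrite mulr_ge0 ?xi_ge0//; exact: f0.
rewrite -real_integralD; [|by move=> w; exact: nn..| |]; try exact: measurable_pay.
by apply: eq_integral => w _ /=; rewrite mulrDr.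
Qed.

Lemma shortfall_comp (k : R -> R) :
  shortfall M L (k \o xi) = price M ((fun x => Num.max (L - k x) 0) \o xi).
Proof. by []. Qed.

Lemma is_xi2E x2 : is_xi2 M L eps x2 <->
  price M ((fun x => L * (x2 <= x)%R%:R) \o xi) = eps%:E.
Proof.
rewrite /is_xi2; suff -> : (fun w => L * \1_[set v | x2 <= xi v] w) =
  ((fun x => L * (x2 <= x)%R%:R) \o xi) by [].
by apply/funext => w /=; congr (_ * _); exact: indic_natr.
Qed.

Lemma measurable_ltr_cst a : measurable_fun setT (fun x : R => x < a).
Proof. exact: measurable_fun_ltr. Qed.

Lemma measurable_ler_cst a : measurable_fun setT (fun x : R => a <= x).
Proof. exact: measurable_fun_ler. Qed.

Lemma measurable_step x2 : measurable_fun setT (fun x : R => L * (x2 <= x)%R%:R).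
Proof.
rewrite (_ : (fun _ => _) = (fun x : R => if x2 <= x then L else 0)); last first.
  by apply/funext => x; case: ifP; rewrite ?mulr1 ?mulr0.
by apply: measurable_fun_ifT => //; exact: measurable_ler_cst.
Qed.

Lemma measurable_scaled_floor K l : measurable_fun setT (fun x : R => floor_wealth U D K (l * x)).
Proof.
apply: (@measurableT_comp _ _ _ _ _ _ (floor_wealth U D K)).
  exact: measurable_floor_wealth.
exact: mulrl_measurable.
Qed.

Lemma measurable_insured l x2 : measurable_fun setT (insured_wealth U D L l x2).
Proof.
apply: measurable_fun_ifT => //; first exact: measurable_ltr_cst.
exact: measurable_scaled_floor.
Qed.

Lemma measurable_relaxed l mu : measurable_fun setT (relaxed_wealth U D L l mu).
Proof.
apply: measurable_fun_ifT; [|exact: measurable_scaled_floor..].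
by apply: measurable_fun_ltr => //; exact: mulrl_measurable.
Qed.

Lemma measurable_floor_shortfall l :
  measurable_fun setT (fun x : R => Num.max (L - floor_wealth U D 0 (l * x)) 0).
Proof.
apply: measurable_funrpos; apply: measurable_funB => //; exact: measurable_scaled_floor.
Qed.

Lemma insured_ge0 l x2 x : 0 <= insured_wealth U D L l x2 x.
Proof. by rewrite /insured_wealth; case: ifP => // _; apply: floor_wealth_ge0 => //; exact: ltW. Qed.

Lemma relaxed_ge0 l mu x : 0 <= relaxed_wealth U D L l mu x.
Proof. by rewrite /relaxed_wealth; case: ifP => _; apply: floor_wealth_ge0 => //; exact: ltW. Qed.

Lemma shortfall_insured l x2 : 0 < l ->
  shortfall M L (insured_wealth U D L l x2 \o xi) =
  price M ((fun x => L * (x2 <= x)%R%:R) \o xi).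
Proof.
move=> l0; rewrite shortfall_comp; apply: eq_price => w w0 /=.
rewrite /insured_wealth; case: ltP => h; last by rewrite subr0 mulr1 max_l// ltW.
have lw0 : 0 < l * xi w by rewrite mulr_gt0.
by rewrite mulr0 max_r// subr_le0; exact: floor_wealth_ge.
Qed.

Lemma relaxed_optimal l mu : tangent_point U D < L -> 0 < mu -> mu <= l ->
  price M (relaxed_wealth U D L l mu \o xi) = x0%:E ->
  shortfall M L (relaxed_wealth U D L l mu \o xi) = eps%:E ->
  optimal M U D L eps x0 (relaxed_wealth U D L l mu \o xi) /\
  lagrange_multipliers M U D L eps x0 (relaxed_wealth U D L l mu \o xi) l (l - mu).
Proof.
move=> TL mu0 mul pX sX.
have cX : claim M (relaxed_wealth U D L l mu \o xi).
  apply: claim_of_state_price; rewrite ?pX ?ltry//; first exact: measurable_relaxed.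
  by move=> x _; exact: relaxed_ge0.
have LX : lagrange_multipliers M U D L eps x0 (relaxed_wealth U D L l mu \o xi) l (l - mu).
  apply: multipliers_of_score => //; [lra|lra|].
  by move=> w y w0 y0; exact: relaxed_wealth_max.
by split => //; exact: optimal_of_multipliers LX.
Qed.

(** [E[xi L 1_{xi >= c}]] decreases continuously in [c], since [xi] has no
    atom, from [E[xi L]] to 0. *)
Lemma insurance_level_exists : (eps%:E < price M (cst L))%E ->
  exists x2, is_xi2 M L eps x2.
Proof.
move=> hL.
pose f c w := xi w * (L * (c <= xi w)%R%:R).
have mf c : measurable_fun setT (f c) by exact: measurable_pay (measurable_step c).
have f0 w : f 0 w = xi w * L by rewrite /f xi_ge0 mulr1.
have intf0 : (\int[P]_w (f 0 w)%:E = price M (cst L))%E.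
  by rewrite priceE; apply: eq_integral => w _; rewrite f0.
have [|||||||c _ hc] := @integral_IVT _ _ _ P f (cst 0) 0 eps mf.
- exact: measurable_cst.
- move=> c w c0; have h : 0 <= xi w * L by rewrite mulr_ge0 ?xi_ge0// ltW.
  by rewrite f0 /f; case: (c <= xi w); rewrite ?mulr1 ?mulr0 ?mulr0 ?lexx ?h.
- by rewrite intf0; apply: price_cst_fin => //; exact: ltW.
- move=> c c0; apply: filterS (ae_state_price_neq hatomless c) => w wc.
  have e : \forall y \near c, f y w = f c w.
    move: wc; rewrite neq_lt => /orP[h|h]; near=> y; rewrite /f.
      rewrite !leNgt h/=; suff -> : xi w < y by [].
      by near: y; exact: lt_nbhsr.
    rewrite (ltW h); suff -> : y <= xi w by [].
    by apply: ltW; near: y; exact: lt_nbhsl.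
  rewrite /prop_for /continuous_at; apply: cvg_trans (_ : f c w @[_ --> c] --> _); last exact: cvg_cst.
  by apply: near_eq_cvg; apply: filterS e => y /esym.
- apply: aeW => w; apply: cvg_trans (_ : (0:R) @[_ --> +oo] --> _); last exact: cvg_cst.
  apply: near_eq_cvg; near=> y; rewrite /f leNgt.
  have -> : xi w < y by near: y; apply: nbhs_pinfty_gt; exact: num_real.
  by rewrite !mulr0.
- by rewrite integral0 lte_fin.
- by rewrite intf0; exact: ltW.
by exists c; apply/is_xi2E; rewrite priceE.
Unshelve. all: end_near. Qed.

(** On the states of [A] the wealth decreases to [L] as [l] grows.  Its price
    does so continuously: at a given [l], [floor_wealth] jumps only in the states
    where [l * xi] is the cutoff, a null set. *)
Lemma budget_multiplier_exists (A : R -> bool) (r : R -> R) (a : R) :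
  measurable_fun setT A -> measurable_fun setT r -> (forall x, 0 <= r x) -> 0 < a ->
  let X l x := if A x then floor_wealth U D L (l * x) else r x in
  (x0%:E <= price M (X a \o xi))%E -> (price M (X a \o xi) < +oo)%E ->
  (price M ((fun x => if A x then L else r x) \o xi) < x0%:E)%E ->
  exists2 l, a <= l & price M (X l \o xi) = x0%:E.
Proof.
move=> mA mr r0 a0 X pa pfin plim.
have mX l : measurable_fun setT (X l).
  by apply: measurable_fun_ifT => //; exact: measurable_scaled_floor.
pose f l w := xi w * X l (xi w).
have X0 l x : 0 <= X l x.
  by rewrite /X; case: ifP => // _; apply: floor_wealth_ge0 => //; exact: ltW.
have [|||||||l al hl] := @integral_IVT _ _ _ P f
    (fun w => xi w * (if A (xi w) then L else r (xi w))) a x0 (fun l => measurable_pay M (mX l)).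
- by apply: (@measurable_pay _ _ _ _ _ _ M (fun x => if A x then L else r x)); exact: measurable_fun_ifT.
- move=> l w al; rewrite /f mulr_ge0 ?xi_ge0//=.
  have := xi_ge0 w; rewrite le_eqVlt => /predU1P[<-|w0]; first by rewrite !mul0r.
  rewrite ler_pM2l// /X; case: ifP => // _; apply: floor_wealth_le => //.
    by rewrite mulr_gt0.
  by rewrite ler_pM2r.
- by rewrite -priceE.
- move=> l al; have l0 : 0 < l by lra.
  have aec : {ae P, forall w, (l * xi w)%:E != floor_cutoff U D L}.
    case E : (floor_cutoff U D L) => [c||]; [|exact: aeW..].
    apply: filterS (ae_state_price_neq hatomless (c / l)) => w.
    by apply: contra => /eqP[<-]; rewrite mulrAC divff ?mul1r// gt_eqF.
  apply: filterS2 (ae_state_price_gt0 hatomless) aec => w w0 hw.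
  rewrite /prop_for /continuous_at /f; apply: cvgMr; rewrite /X; case: (A (xi w)); last exact: cvg_cst.
  have c1 : {for l, continuous (fun l : R => l * xi w)} by exact: mulrr_continuous.
  have c2 : {for l * xi w, continuous (floor_wealth U D L)}.
    by apply: floor_wealth_continuous => //; rewrite mulr_gt0.
  exact: (continuous_comp c1 c2).
- apply: filterS (ae_state_price_gt0 hatomless) => w w0.
  rewrite /f; apply: cvgMr; rewrite /X; case: (A (xi w)); last exact: cvg_cst.
  apply: (@cvg_comp _ _ _ (fun l => l * xi w) (floor_wealth U D L)); last exact: floor_wealth_cvgy.
  apply/cvgryPge => z; near=> l; rewrite -ler_pdivrMr//.
- by rewrite -(priceE M ((fun x => if A x then L else r x) \o xi)).
- by rewrite -priceE.
by exists l => //; rewrite priceE.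
Unshelve. all: end_near. Qed.

Section nonredundant.
Context (lB : R) (lB0 : 0 < lB).
Hypothesis pB : price M ((fun x => floor_wealth U D 0 (lB * x)) \o xi) = x0%:E.
Hypothesis sB : (eps%:E < shortfall M L ((fun x => floor_wealth U D 0 (lB * x)%R) \o xi))%E.

(** The benchmark wealth exceeds [L] wherever it does not vanish.  Were it to
    vanish only for [xi >= x2], its shortfall would be at most [eps]. *)
Lemma default_threshold_lt x2 : L <= tangent_point U D -> is_xi2 M L eps x2 ->
  cB < lB * x2.
Proof.
move=> LT /is_xi2E hx2; rewrite ltNge; apply/negP => h.
move: sB; rewrite shortfall_comp -hx2 ltNge => /negP; apply.
apply: price_le; [exact: measurable_floor_shortfall|exact: measurable_step|].
move=> x x0'; rewrite le_max lexx orbT/= ge_max; apply/andP; split; last first.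
  by rewrite mulr_ge0// ltW.
have [x2x|xx2] := leP x2 x.
  by rewrite mulr1; have := floor_wealth_ge0 hU D0 (lB * x) (lexx 0); lra.
rewrite mulr0 floor_wealth0E// ifT; last first.
  by apply: lt_le_trans h; rewrite ltr_pM2l.
have lx0 : 0 < lB * x by rewrite mulr_gt0.
have := floor_wealth_ge hU D L lx0.
rewrite floor_wealth_lt_cutoff//; [lra|exact: ltW|].
by apply: lt_le_trans h; rewrite ltr_pM2l.
Qed.

Lemma price_constant_le : (eps%:E < price M (cst L))%E.
Proof.
apply: lt_le_trans sB _; rewrite shortfall_comp.
apply: (@price_le _ (cst L)); [exact: measurable_floor_shortfall|exact: measurable_cst|].
move=> x _; rewrite le_max lexx orbT/= ge_max (ltW L0) andbT.
by have := floor_wealth_ge0 hU D0 (lB * x) (lexx 0); lra.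
Qed.

(** Otherwise [l < lB] and the insured wealth dominates the benchmark wealth,
    strictly wherever the latter is positive, although both cost [x0]. *)
Lemma insured_threshold_ge l x2 : L <= tangent_point U D -> 0 < l ->
  is_xi2 M L eps x2 ->
  price M (insured_wealth U D L l x2 \o xi) = x0%:E -> cB <= l * x2.
Proof.
move=> LT l0 hx2 pX; rewrite leNgt; apply/negP => h.
have hB := default_threshold_lt LT hx2.
have c0 : 0 < cB by exact: tslope_gt0.
have x20 : 0 < x2 by rewrite -(pmulr_rgt0 _ lB0); lra.
have llB : l < lB by rewrite -(ltr_pM2r x20); lra.
pose X := insured_wealth U D L l x2.
pose B := fun x => floor_wealth U D 0 (lB * x).
have BX x : 0 < x -> B x <= X x /\ (X x = B x -> B x = 0).
  move=> x0'; rewrite /X /B floor_wealth0E//; case: ifPn => hx; last first.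
    by split=> //; exact: insured_ge0.
  have xx2 : x < x2 by rewrite -(ltr_pM2l lB0); lra.
  have lx : l * x < cB by apply: lt_trans h; rewrite ltr_pM2l.
  rewrite /insured_wealth xx2 floor_wealth_lt_cutoff//; last exact: ltW.
  have : I (lB * x) < I (l * x).
    by apply: marginal_inv_lt; rewrite ?mulr_gt0// ltr_pM2r.
  by move=> hI; split; [lra|move=> e; exfalso; lra].
have mX : measurable_fun setT X by exact: measurable_insured.
have mB : measurable_fun setT B by exact: measurable_scaled_floor.
have mXB : measurable_fun setT (fun x => X x - B x) by exact: measurable_funB.
have B0 x : 0 <= B x by exact: floor_wealth_ge0.
have dX : price M ((fun x => X x - B x)%R \o xi) = 0%E.
  have : price M (X \o xi) = (price M (B \o xi) + price M ((fun x => X x - B x)%R \o xi))%E.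
    rewrite -price_add//; last by move=> x /BX[? _]; lra.
    by apply: eq_price => w _ /=; rewrite addrC subrK.
  rewrite pX pB; case: (price M ((fun x => X x - B x)%R \o xi)) => // r.
  by rewrite -EFinD => -[]/eqP; rewrite addrC -subr_eq subrr eq_sym => /eqP->.
have : ae_eq P setT (fun w => (xi w * (X (xi w) - B (xi w)))%:E) (cst 0%E).
  apply/ae_eq_integral_abs => //; first by apply/measurable_EFinP; exact: measurable_pay mXB.
  rewrite -[RHS]dX priceE; apply: eq_integral => w _; congr (_%:E).
  rewrite ger0_norm//; have := xi_ge0 w; rewrite le_eqVlt => /predU1P[<-|w0]; first by rewrite mul0r.
  by rewrite mulr_ge0 ?xi_ge0//; have [? _] := BX _ w0; lra.
move=> ae0; have : price M (B \o xi) = 0%E.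
  rewrite priceE -[RHS](integral0 P setT); apply: ae_eq_integral => //.
    by apply/measurable_EFinP; exact: measurable_pay mB.
  apply: filterS ae0 => w /= /(_ Logic.I) [] /eqP; rewrite mulf_eq0 => /orP[/eqP->|XB0] _.
    by rewrite mul0r.
  have := xi_ge0 w; rewrite le_eqVlt => /predU1P[<-|w0]; first by rewrite mul0r.
  by have [_ ->] := BX _ w0; rewrite ?mulr0//; apply/eqP; rewrite -subr_eq0.
by rewrite pB => -[] e; move: x00; rewrite e ltxx.
Qed.

(** The tie condition fixes [l2]; its sign is the only condition left, and
    it follows from [insured_threshold_ge]. *)
Lemma insured_optimal l x2 : L <= tangent_point U D -> 0 < l -> is_xi2 M L eps x2 ->
  price M (insured_wealth U D L l x2 \o xi) = x0%:E ->
  optimal M U D L eps x0 (insured_wealth U D L l x2 \o xi) /\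
  exists l2, lagrange_multipliers M U D L eps x0 (insured_wealth U D L l x2 \o xi) l l2.
Proof.
move=> LT l0 hx2 pX.
have h2 := insured_threshold_ge LT l0 hx2 pX.
have lx20 : 0 < l * x2 by apply: lt_le_trans h2; exact: tslope_gt0.
have x20 : 0 < x2 by rewrite -(pmulr_rgt0 _ l0).
have cX : claim M (insured_wealth U D L l x2 \o xi).
  apply: claim_of_state_price; rewrite ?pX ?ltry//; first exact: measurable_insured.
  by move=> x _; exact: insured_ge0.
have sX : shortfall M L (insured_wealth U D L l x2 \o xi) = eps%:E.
  by rewrite shortfall_insured//; exact/is_xi2E.
pose l2 := - floor_value U D L (l * x2) / (x2 * L).
have l20 : 0 <= l2.
  apply: divr_ge0; last by rewrite mulr_ge0// ltW.
  by rewrite oppr_ge0; apply: floor_value_le0 => //; exact: ltW.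
have LX : lagrange_multipliers M U D L eps x0 (insured_wealth U D L l x2 \o xi) l l2.
  apply: multipliers_of_score => //; first exact: ltW.
  by move=> w y w0 y0; exact: insured_wealth_max.
by split; [exact: optimal_of_multipliers LX|exists l2].
Qed.

Hypothesis xL : (price M (cst L) < x0%:E + eps%:E)%E.

(** The floor changes the demand by a bounded amount only, hence it preserves
    the finiteness of the price. *)
Lemma floor_wealth_le_benchmark s : 0 < s ->
  floor_wealth U D L s <= floor_wealth U D 0 s + (L + floor_wealth U D L cB).
Proof.
move=> s0; have c0 : 0 < cB by exact: tslope_gt0.
have k0 := floor_wealth_ge0 hU D0 cB (ltW L0).
rewrite floor_wealth0E//; case: ifPn => sB'.
  rewrite /floor_wealth; case: ifP => _; last first.
    by have := marginal_inv_gt0 hU s0; have := D0; move: k0; rewrite /floor_wealth; lra.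
  move: k0; rewrite /floor_wealth; have := L0; lra.
rewrite -leNgt in sB'.
by have := floor_wealth_le hU D L c0 sB'; have := L0; lra.
Qed.

(** A profile [g] that falls short of [L] by a payoff worth [eps] costs
    [E[xi L] - eps], which the Slater condition places below [x0]. *)
Lemma capped_price_lt (g h : R -> R) : measurable_fun setT g -> measurable_fun setT h ->
  (forall x, 0 < x -> 0 <= g x) -> (forall x, 0 < x -> 0 <= h x) ->
  (forall x, 0 < x -> g x + h x = L) -> price M (h \o xi) = eps%:E ->
  (price M (g \o xi) < x0%:E)%E.
Proof.
move=> mg mh g0 h0 gh ph; have := xL.
have -> : price M (cst L) = (price M (g \o xi) + price M (h \o xi))%E.
  rewrite -price_add//; apply: eq_price => w w0 /=.
  by rewrite gh.
by rewrite ph lteD2rE.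
Qed.

Lemma benchmark_bounded_fin (k : R -> R) c : measurable_fun setT k ->
  0 <= c -> (forall x, 0 < x -> 0 <= k x <= floor_wealth U D 0 (lB * x) + c) ->
  (price M (k \o xi) < +oo)%E.
Proof.
move=> mk c0 kc.
have mB : measurable_fun setT (fun x : R => floor_wealth U D 0 (lB * x)) by exact: measurable_scaled_floor.
have m' : measurable_fun setT (fun x : R => floor_wealth U D 0 (lB * x) + c) by exact: measurable_funD.
apply: (le_lt_trans (price_le mk m' kc)).
rewrite (@price_add (fun x => floor_wealth U D 0 (lB * x)) (cst c))//; last first.
  by move=> x _; exact: floor_wealth_ge0.
rewrite pB; apply: lte_add_pinfty; rewrite ?ltry//.
exact: price_cst_fin.
Qed.

(** The search for [l] starts at [lB]: there the wealth dominates the benchmark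
    wealth, so it costs at least [x0], and its price is finite. *)
Lemma insured_params_exist : L <= tangent_point U D ->
  exists l x2, [/\ 0 < l, is_xi2 M L eps x2 & price M (insured_wealth U D L l x2 \o xi) = x0%:E].
Proof.
move=> LT; have [x2 hx2] := insurance_level_exists price_constant_le.
have hB := default_threshold_lt LT hx2.
have [|||||||l al pl] := @budget_multiplier_exists (fun x => x < x2) (cst 0) lB.
- exact: measurable_ltr_cst.
- exact: measurable_cst.
- by [].
- exact: lB0.
- rewrite -pB; apply: (@price_le _ (insured_wealth U D L lB x2)).
  + exact: measurable_scaled_floor.
  + exact: measurable_insured.
  + move=> x x0'; rewrite floor_wealth_ge0//= /insured_wealth; case: ltP => h.
      by apply: floor_wealth0_le => //; [exact: ltW|rewrite mulr_gt0].
    rewrite floor_wealth0E// ifF//; apply/negbTE; rewrite -leNgt; apply: (le_trans (ltW hB)).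
    by rewrite ler_pM2l.
- apply: (@benchmark_bounded_fin (insured_wealth U D L lB x2) (L + floor_wealth U D L cB)).
  + exact: measurable_insured.
  + by rewrite addr_ge0 ?floor_wealth_ge0// ltW.
  + move=> x x0'; rewrite insured_ge0/= /insured_wealth; case: ifP => _.
      by apply: floor_wealth_le_benchmark; rewrite mulr_gt0.
    by rewrite !addr_ge0 ?floor_wealth_ge0// ltW.
- apply: (@capped_price_lt (fun x => if x < x2 then L else 0) (fun x => L * (x2 <= x)%R%:R)).
  + by apply: measurable_fun_ifT => //; exact: measurable_ltr_cst.
  + exact: measurable_step.
  + by move=> x _; case: ifP => // _; exact: ltW.
  + by move=> x _; rewrite mulr_ge0// ltW.
  + by move=> x _; case: ltP; rewrite ?mulr0 ?mulr1 ?addr0 ?add0r.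
  + exact/is_xi2E.
by exists l, x2; split => //; exact: lt_le_trans al.
Qed.

(** Both wealths are at least [L] in the states where they differ. *)
Lemma shortfall_relaxed l mu : tangent_point U D < L -> 0 < mu -> mu <= l ->
  shortfall M L (relaxed_wealth U D L l mu \o xi) =
  shortfall M L ((fun x => floor_wealth U D 0 (mu * x)) \o xi).
Proof.
move=> TL mu0 mul; rewrite !shortfall_comp; apply: eq_price => w w0 /=.
rewrite /relaxed_wealth; case: ifPn => // h.
have mw0 : 0 < mu * xi w by rewrite mulr_gt0.
have lw0 : 0 < l * xi w by rewrite mulr_gt0//; lra.
have D1 := D0; have [DT te] := tangent_pointP hU D0.
rewrite max_r; last by rewrite subr_le0; exact: floor_wealth_ge.
rewrite max_r// floor_wealth0E// ifT; last first.
  by apply: (lt_trans h); rewrite marginal_ltE//; lra.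
have : L - D < I (mu * xi w) by rewrite marginal_inv_gtE//; lra.
lra.
Qed.

(** The shortfall exceeds [eps] at [mu = lB] and vanishes as [mu] tends to 0;
    in terms of the parameter [t = mu^-1] it is nonincreasing. *)
Lemma risk_multiplier_exists : exists mu, [/\ 0 < mu, mu <= lB &
  shortfall M L ((fun x => floor_wealth U D 0 (mu * x)) \o xi) = eps%:E].
Proof.
pose a := lB^-1; have a0 : 0 < a by rewrite invr_gt0.
pose f t w := xi w * Num.max (L - floor_wealth U D 0 (t^-1 * xi w)) 0.
have mf t : measurable_fun setT (f t).
  exact: measurable_pay (measurable_floor_shortfall t^-1).
have intf t : (\int[P]_w (f t w)%:E =
    shortfall M L ((fun x => floor_wealth U D 0 (t^-1 * x)%R) \o xi))%E.
  by rewrite shortfall_comp priceE.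
have fL t w : 0 <= f t w <= xi w * L.
  apply/andP; split; first by rewrite mulr_ge0 ?xi_ge0// le_max lexx orbT.
  rewrite ler_wpM2l ?xi_ge0// ge_max (ltW L0) andbT.
  by have := floor_wealth_ge0 hU D0 (t^-1 * xi w) (lexx 0); lra.
have [|||||||t at' ht] := @integral_IVT _ _ _ P f (cst 0) a eps mf.
- exact: measurable_cst.
- move=> t w at'; have /andP[-> _]/= := fL t w; rewrite /f.
  have := xi_ge0 w; rewrite le_eqVlt => /predU1P[<-|w0]; first by rewrite !mul0r.
  rewrite ler_pM2l//; have t0 : 0 < t by lra.
  suff : floor_wealth U D 0 (a^-1 * xi w) <= floor_wealth U D 0 (t^-1 * xi w).
    by move=> h; rewrite ge_max !le_max lexx !orbT andbT; apply/orP; left; lra.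
  apply: floor_wealth_le => //; first by rewrite mulr_gt0// invr_gt0.
  by rewrite ler_pM2r// lef_pV2// posrE.
- apply: le_lt_trans (price_cst_fin xi_fin (ltW L0)); rewrite priceE.
  apply: real_integral_le => //.
  + by move=> w; have /andP[] := fL a w.
  + by apply: measurable_funM => //; exact: mxi.
  + by move=> w; have /andP[] := fL a w.
- move=> t at'; have t0 : 0 < t by lra.
  apply: filterS2 (ae_state_price_gt0 hatomless) (ae_state_price_neq hatomless (cB * t)) => w w0 hw.
  rewrite /prop_for /continuous_at /f; apply: cvgMr.
  have c1 : {for t, continuous (fun t : R => t^-1 * xi w)}.
    by apply: cvgMl; apply: inv_continuous; rewrite gt_eqF.
  have c2 : {for t^-1 * xi w, continuous (floor_wealth U D 0)}.
    apply: floor_wealth_continuous => //; first by rewrite mulr_gt0// invr_gt0.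
    rewrite floor_cutoff0//; apply: contra hw => /eqP[<-].
    by rewrite mulrAC mulVf ?mul1r// gt_eqF.
  have cf := continuous_comp c1 c2.
  apply: (@continuous_max _ _ (fun t : R => L - floor_wealth U D 0 (t^-1 * xi w)) (cst 0)); last exact: cvg_cst.
  by apply: cvgB => //; exact: cvg_cst.
- apply: filterS (ae_state_price_gt0 hatomless) => w w0.
  have [e e0 he] := floor_wealth0_unbounded hU D0 L.
  apply: cvg_trans (_ : (0:R) @[_ --> +oo] --> _); last exact: cvg_cst.
  apply: near_eq_cvg; near=> t; rewrite /f max_r ?mulr0// subr_le0.
  have t0 : 0 < t by near: t; apply: nbhs_pinfty_gt; exact: num_real.
  apply: he; first by rewrite mulr_gt0// invr_gt0.
  rewrite mulrC ltr_pdivrMr// mulrC -ltr_pdivrMr//.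
  by near: t; apply: nbhs_pinfty_gt; exact: num_real.
- by rewrite integral0 lte_fin.
- by rewrite intf /a invrK ltW.
have t0 : 0 < t by lra.
exists t^-1; split; first by rewrite invr_gt0.
  by rewrite -[lB]invrK lef_pV2// posrE.
by rewrite -intf.
Unshelve. all: end_near. Qed.

(** The shortfall depends on [mu] alone, which is thus chosen first; the budget
    then determines [l], in a search starting at [lB >= mu]. *)
Lemma relaxed_params_exist : tangent_point U D < L ->
  exists l mu, [/\ 0 < mu, mu <= l, price M (relaxed_wealth U D L l mu \o xi) = x0%:E &
    shortfall M L (relaxed_wealth U D L l mu \o xi) = eps%:E].
Proof.
move=> TL; have [mu [mu0 muB smu]] := risk_multiplier_exists.
have D1 := D0; have [DT te] := tangent_pointP hU D0.
pose A x := mu * x < U' (L - D).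
have mA : measurable_fun setT A by apply: measurable_fun_ltr => //; exact: mulrl_measurable.
have kL x : 0 < x -> ~~ A x -> floor_wealth U D 0 (mu * x) <= L.
  move=> x0'; rewrite /A -leNgt => h; rewrite floor_wealth0E//; case: ifPn => _; last lra.
  have mx0 : 0 < mu * x by rewrite mulr_gt0.
  have : ~~ (L - D < I (mu * x)) by rewrite marginal_inv_gtE// -?leNgt//; lra.
  by rewrite -leNgt; lra.
have [|||||||l al pl] := @budget_multiplier_exists A (fun x => floor_wealth U D 0 (mu * x)) lB.
- exact: mA.
- exact: measurable_scaled_floor.
- by move=> x; exact: floor_wealth_ge0.
- exact: lB0.
- rewrite -pB; apply: (@price_le _ (relaxed_wealth U D L lB mu)).
  + exact: measurable_scaled_floor.
  + exact: measurable_relaxed.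
  + move=> x x0'; rewrite floor_wealth_ge0//= /relaxed_wealth; case: ifP => h.
      by apply: floor_wealth0_le => //; [exact: ltW|rewrite mulr_gt0].
    by apply: floor_wealth_le => //; rewrite ?mulr_gt0// ler_pM2r.
- apply: (@benchmark_bounded_fin (relaxed_wealth U D L lB mu) (L + floor_wealth U D L cB)).
  + exact: measurable_relaxed.
  + by rewrite addr_ge0 ?floor_wealth_ge0// ltW.
  + move=> x x0'; rewrite relaxed_ge0/= /relaxed_wealth; case: ifPn => h.
      by apply: floor_wealth_le_benchmark; rewrite mulr_gt0.
    have := kL x x0' h; have := floor_wealth_ge0 hU D0 (lB * x) (lexx 0).
    by have := floor_wealth_ge0 hU D0 cB (ltW L0); lra.
- apply: (@capped_price_lt (fun x => if A x then L else floor_wealth U D 0 (mu * x))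
    (fun x => Num.max (L - relaxed_wealth U D L lB mu x) 0)).
  + by apply: measurable_fun_ifT => //; exact: measurable_scaled_floor.
  + by apply: measurable_funrpos; apply: measurable_funB => //; exact: measurable_relaxed.
  + by move=> x _; case: ifP => // _; [exact: ltW|exact: floor_wealth_ge0].
  + by move=> x _; rewrite le_max lexx orbT.
  + move=> x x0'; rewrite /relaxed_wealth -/(A x); case: ifPn => h.
      rewrite max_r ?addr0// subr_le0; apply: floor_wealth_ge => //.
      by rewrite mulr_gt0.
    by rewrite max_l ?subr_ge0 ?kL// addrC subrK.
  + by rewrite -smu -(shortfall_relaxed TL mu0 muB).
exists l, mu; split => //; first exact: le_trans al.
by rewrite shortfall_relaxed//; exact: le_trans al.
Qed.

End nonredundant.

End esq.

(** A claim of finite price and finite shortfall bounds the price of the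
    constant [L]. *)
Lemma state_price_integrable (R : realType) (d : measure_display)
    (Omega : measurableType d) (P : probability Omega R) (T : R) (m : nat)
    (M : market P T m) (L x0 : R) (e : \bar R) X :
  0 < L -> claim M X -> price M X = x0%:E -> (shortfall M L X <= e)%E -> (e < +oo)%E ->
  (\int[P]_w (state_price M w)%:E < +oo)%E.
Proof.
move=> L0 cX pX sX e_fin.
have := le_lt_trans (price_bound L0 cX pX sX) (lte_add_pinfty (ltry x0) e_fin).
rewrite price_cst ?ltW// !ltey; apply: contra => /eqP->.
by rewrite gt0_muley ?lte_fin.
Qed.

Theorem proposition6 (R : realType) (d : measure_display)
    (Omega : measurableType d) (P : probability Omega R) (T : R) (m : nat)
    (M : market P T m) (U : R -> R) (D L eps x0 : R)
    (hatomless : atomless_rv P (state_price M))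
    (hU : is_utility U)
    (hD : 0 < D) (hL : 0 < L) (heps : 0 < eps) (hx0 : 0 < x0)
    (hsol : exists X, optimal M U D L eps x0 X)
    (hnonred : non_redundant M U D L eps x0) :
  let xi := state_price M in
  let Dhat := tangent_point U D in
  [/\ L <= D ->
        (slater M L eps x0 ->
           exists l1 xi2, esq_low_params M U D L eps x0 l1 xi2) /\
        forall l1 xi2, esq_low_params M U D L eps x0 l1 xi2 ->
          let X := esq_low xi U D L l1 xi2 in
          optimal M U D L eps x0 X /\
          exists l2, lagrange_multipliers M U D L eps x0 X l1 l2,
      D < L <= Dhat ->
        (slater M L eps x0 ->
           exists l1 xi2, esq_mid_params M U D L eps x0 l1 xi2) /\
        forall l1 xi2, esq_mid_params M U D L eps x0 l1 xi2 ->
          let X := esq_mid xi U D L l1 xi2 in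
          optimal M U D L eps x0 X /\
          exists l2, lagrange_multipliers M U D L eps x0 X l1 l2 &
      Dhat < L ->
        (slater M L eps x0 ->
           exists l1 l2, esq_high_params M U D L eps x0 l1 l2) /\
        forall l1 l2, esq_high_params M U D L eps x0 l1 l2 ->
          let X := esq_high xi U D L l1 l2 in
          optimal M U D L eps x0 X /\
          lagrange_multipliers M U D L eps x0 X l1 l2].
Proof.
move=> xi Dhat.
have [X0 [[[cX0 pX0] sX0 _] _]] := hsol.
have xi_fin := state_price_integrable hL cX0 pX0 sX0 (ltry eps).
have slaterL : slater M L eps x0 -> (price M (cst L) < x0%:E + eps%:E)%E.
  move=> [X [cX pX] sX]; apply: le_lt_trans (price_bound hL cX pX (lexx _)) _.
  by rewrite lteD2lE.
have [lB [lB0]] := hnonred; rewrite benchmark_wealthE// => pB sB.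
have [DT _] := tangent_pointP hU hD.
split.
- move=> LD; have LT : L <= Dhat by exact: le_trans LD (ltW DT).
  split=> [/slaterL xL|l1 x2 [l10 hx2]].
    have [l [x2 [l0 hx2 pX]]] := insured_params_exist hU hatomless hD hL heps xi_fin lB0 pB sB xL LT.
    by exists l, x2; split => //; rewrite esq_lowE.
  rewrite esq_lowE// => pX.
  exact: (insured_optimal hU hatomless hD hL hx0 xi_fin lB0 pB sB LT l10 hx2 pX).
- move=> /andP[DL LT].
  split=> [/slaterL xL|l1 x2 [l10 hx2]].
    have [l [x2 [l0 hx2 pX]]] := insured_params_exist hU hatomless hD hL heps xi_fin lB0 pB sB xL LT.
    by exists l, x2; split => //; rewrite esq_midE.
  rewrite esq_midE// => pX.
  exact: (insured_optimal hU hatomless hD hL hx0 xi_fin lB0 pB sB LT l10 hx2 pX).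
- move=> TL.
  split=> [/slaterL xL|l1 l2 [/andP[l20 l21]]].
    have [l [mu [mu0 mul pX sX]]] := relaxed_params_exist hU hatomless hD hL heps xi_fin lB0 pB sB xL TL.
    have m0 : 0 <= l - mu by rewrite subr_ge0.
    have ml : l - mu < l by rewrite ltrBlDr ltrDl.
    by exists l, (l - mu); split; rewrite ?m0// esq_highE// subKr.
  rewrite esq_highE// => pX sX.
  have mu0 : 0 < l1 - l2 by rewrite subr_gt0.
  have mul : l1 - l2 <= l1 by rewrite gerBl.
  have := relaxed_optimal hU hatomless hD hL xi_fin TL mu0 mul pX sX.
  by rewrite subKr.
Qed.
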